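(* Let $q_1,q_2\in\mathbb{K}\setminus\{0,1\}$ and $\lambda\in\mathbb{K}^*$ be such that $q_i$ is a primitive $l_i$-th root of unity for $i=1,2$ and $\lambda$ is an $l_1$-th root of unity (i.e. $\lambda^{l_1}=1$). Then the PI-degree of the rank-two alternative quantum Weyl algebra $\mathcal{A}_2^{\underline{q},\Lambda}$ is $l_1l_2$.
   Context: $\mathbb{K}$ is an algebraically closed field of arbitrary characteristic. The alternative quantum Weyl algebra $\mathcal{A}_2^{\underline{q},\Lambda}$ of rank two, with $\underline q=(q_1,q_2)$ and $\Lambda=(\lambda_{ij})$ the $2\times2$ multiplicatively antisymmetric matrix with $\lambda_{11}=\lambda_{22}=1$, $\lambda_{12}=\lambda$, $\lambda_{21}=\lambda^{-1}$, is the unital associative $\mathbb{K}$-algebra generated by $x_1,y_1,x_2,y_2$ subject to $$x_1x_2=\lambda x_2x_1,\quad x_1y_2=\lambda^{-1}y_2x_1,\quad y_1y_2=\lambda y_2y_1,\quad y_1x_2=\lambda^{-1}x_2y_1,$$ $$x_1y_1-q_1y_1x_1=1,\qquad x_2y_2-q_2y_2x_2=1.$$ It is a noetherian domain, and in the present root-of-unity setting it is a prime polynomial identity (PI) algebra. The PI-degree of a prime PI algebra is half the minimal degree of a (multilinear, monic) polynomial identity it satisfies; equivalently, the square root of the dimension of its total ring of fractions over the center of that ring. *)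

(* Defs.v *)
From HB Require Import structures.
From mathcomp Require Import all_boot all_order all_fingroup all_algebra.
From mathcomp Require Import finmap boolp ring.
From mathcomp.multinomials Require Import monalg.

Set Implicit Arguments.
Unset Strict Implicit.
Unset Printing Implicit Defensive.

Import GRing.Theory.
Local Open Scope ring_scope.

(** * PI-degree of an algebra *)

Section PIDegree.
Variables (K : comNzRingType) (A : algType K).

(* The multilinear polynomial of degree d with coefficients c is
   \sum_s c_s X_(s 0) X_(s 1) ... X_(s (d - 1)) in noncommuting variables. *)
Definition multilinear_eval d (c : 'S_d -> K) (a : 'I_d -> A) : A :=
  \sum_(s : 'S_d) c s *: \prod_(i < d) a (s i).

(* Monic means that some monomial of top degree has coefficient 1; all the
   monomials of a multilinear polynomial have top degree. *)
Definition satisfies_monic_identity (d : nat) : Prop :=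
  exists c : 'S_d -> K,
    (exists s, c s = 1) /\ (forall a : 'I_d -> A, multilinear_eval c a = 0).

Definition minimal_identity_degree (d : nat) : Prop :=
  satisfies_monic_identity d /\
  (forall d' : nat, satisfies_monic_identity d' -> (d <= d')%N).

Definition PI_degree (n : nat) : Prop := minimal_identity_degree n.*2.

End PIDegree.

(** * Quotients by two-sided ideals *)

Section TwoSidedIdeal.
Variables (K : comNzRingType) (F : algType K) (rels : seq F).

Inductive gen_ideal : F -> Prop :=
  | gen_ideal_mem f of f \in rels : gen_ideal f
  | gen_ideal0 : gen_ideal 0
  | gen_idealD f g of gen_ideal f & gen_ideal g : gen_ideal (f + g)
  | gen_idealMl h f of gen_ideal f : gen_ideal (h * f)
  | gen_idealMr h f of gen_ideal f : gen_ideal (f * h).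

Definition gen_idealb : {pred F} := fun f => `[< gen_ideal f >].

Lemma gen_idealP f : reflect (gen_ideal f) (f \in gen_idealb).
Proof. exact: asboolP. Qed.

Lemma gen_ideal_zmod_closed : zmod_closed gen_idealb.
Proof.
split; first exact/gen_idealP/gen_ideal0.
move=> f g /gen_idealP If /gen_idealP Ig; apply/gen_idealP/gen_idealD => //.
by rewrite -mulN1r; apply: gen_idealMl.
Qed.

HB.instance Definition _ :=
  GRing.isZmodClosed.Build F gen_idealb gen_ideal_zmod_closed.

End TwoSidedIdeal.

(* The ideal is not assumed to be decidable: membership is made boolean by
   classical logic.  The properness hypothesis is what makes the quotient a nontrivial ring, as
   required by algType. *)
Definition presented_algebra (K : comNzRingType) (F : algType K)
    (rels : seq F) (_ : ~ gen_ideal rels 1) : Type :=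
  {ideal_quot (gen_idealb rels)}.

Section PresentedAlgebra.
Variables (K : comNzRingType) (F : algType K) (rels : seq F).
Hypothesis proper : ~ gen_ideal rels 1.
Local Notation I := (gen_idealb rels).
Local Notation Q := (presented_algebra proper).

HB.instance Definition _ := GRing.Zmodule.on Q.

Definition presented_pi : F -> Q := \pi_{ideal_quot I}%qT.
Definition presented_repr : Q -> F := fun x => generic_quotient.repr (x : {ideal_quot I}).

Local Notation pi := presented_pi.
Local Notation rep := presented_repr.

Lemma presented_reprK : cancel rep pi.
Proof. exact: (@reprK _ {ideal_quot I}). Qed.

Lemma presented_piP f g : pi f = pi g <-> gen_ideal rels (f - g).
Proof.
split=> [/eqP|/gen_idealP H].
  by rewrite -Quotient.idealrBE => /gen_idealP.
by apply/eqP; rewrite -Quotient.idealrBE.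
Qed.

Lemma presented_pi_is_zmod_morphism : zmod_morphism pi.
Proof. by move=> f g; exact: (raddfB \pi_{ideal_quot I}%qT). Qed.

HB.instance Definition _ :=
  GRing.isZmodMorphism.Build F Q pi presented_pi_is_zmod_morphism.

Definition presented_one : Q := pi 1.
Definition presented_mul (x y : Q) : Q := pi (rep x * rep y).
Definition presented_scale (c : K) (x : Q) : Q := pi (c *: rep x).

Lemma presented_reprP f : gen_ideal rels (rep (pi f) - f).
Proof. by apply/presented_piP; rewrite presented_reprK. Qed.

Lemma presented_mulE f g : presented_mul (pi f) (pi g) = pi (f * g).
Proof.
apply/presented_piP; set f' := rep _; set g' := rep _.
have -> : f' * g' - f * g = (f' - f) * g' + f * (g' - g).
  by rewrite mulrBl mulrBr addrA subrK.
by apply: gen_idealD; [apply: gen_idealMr | apply: gen_idealMl];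
  apply: presented_reprP.
Qed.

Lemma presented_scaleE c f : presented_scale c (pi f) = pi (c *: f).
Proof.
apply/presented_piP; rewrite -scalerBr -[X in c *: X]mul1r scalerAl.
exact/gen_idealMl/presented_reprP.
Qed.

Lemma presented_mulA : associative presented_mul.
Proof.
move=> x y z; rewrite -[x]presented_reprK -[y]presented_reprK.
by rewrite -[z]presented_reprK !presented_mulE mulrA.
Qed.

Lemma presented_mul1x : left_id presented_one presented_mul.
Proof. by move=> x; rewrite -[x]presented_reprK presented_mulE mul1r. Qed.

Lemma presented_mulx1 : right_id presented_one presented_mul.
Proof. by move=> x; rewrite -[x]presented_reprK presented_mulE mulr1. Qed.

Lemma presented_mulDl : left_distributive presented_mul +%R.
Proof.
move=> x y z; rewrite -[x]presented_reprK -[y]presented_reprK.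
by rewrite -[z]presented_reprK -raddfD !presented_mulE -raddfD mulrDl.
Qed.

Lemma presented_mulDr : right_distributive presented_mul +%R.
Proof.
move=> x y z; rewrite -[x]presented_reprK -[y]presented_reprK.
by rewrite -[z]presented_reprK -raddfD !presented_mulE -raddfD mulrDr.
Qed.

Lemma presented_one_neq0 : presented_one != 0.
Proof.
apply/eqP; rewrite /presented_one -(raddf0 pi) => /presented_piP.
by rewrite subr0.
Qed.

HB.instance Definition _ := GRing.Zmodule_isNzRing.Build Q
  presented_mulA presented_mul1x presented_mulx1
  presented_mulDl presented_mulDr presented_one_neq0.

Lemma presented_piM f g : pi (f * g) = pi f * pi g.
Proof. by rewrite -presented_mulE. Qed.

Lemma presented_pi_is_monoid_morphism : monoid_morphism pi.
Proof. by split=> // f g; rewrite presented_piM. Qed.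

HB.instance Definition _ :=
  GRing.isMonoidMorphism.Build F Q pi presented_pi_is_monoid_morphism.

Lemma presented_scalerA a b x :
  presented_scale a (presented_scale b x) = presented_scale (a * b) x.
Proof. by rewrite -[x]presented_reprK !presented_scaleE scalerA. Qed.

Lemma presented_scale1r : left_id 1 presented_scale.
Proof. by move=> x; rewrite -[x]presented_reprK presented_scaleE scale1r. Qed.

Lemma presented_scalerDr : right_distributive presented_scale +%R.
Proof.
move=> c x y; rewrite -[x]presented_reprK -[y]presented_reprK.
by rewrite -raddfD !presented_scaleE -raddfD scalerDr.
Qed.

Lemma presented_scalerDl x :
  {morph presented_scale^~ x : a b / a + b >-> a + b}.
Proof.
move=> a b; rewrite -[x]presented_reprK !presented_scaleE -raddfD.
by rewrite scalerDl.
Qed.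

HB.instance Definition _ := GRing.Zmodule_isLmodule.Build K Q
  presented_scalerA presented_scale1r presented_scalerDr presented_scalerDl.

Lemma presented_piZ c f : pi (c *: f) = c *: pi f.
Proof. by rewrite -presented_scaleE. Qed.

HB.instance Definition _ := GRing.isScalable.Build K F Q *:%R pi presented_piZ.

Lemma presented_scalerAl (c : K) (x y : Q) : c *: (x * y) = (c *: x) * y.
Proof.
rewrite -[x]presented_reprK -[y]presented_reprK.
by rewrite -presented_piM -!presented_piZ -presented_piM scalerAl.
Qed.

HB.instance Definition _ :=
  GRing.Lmodule_isLalgebra.Build K Q presented_scalerAl.

Lemma presented_scalerAr (c : K) (x y : Q) : c *: (x * y) = x * (c *: y).
Proof.
rewrite -[x]presented_reprK -[y]presented_reprK.
by rewrite -presented_piM -!presented_piZ -presented_piM scalerAr.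
Qed.

HB.instance Definition _ :=
  GRing.Lalgebra_isAlgebra.Build K Q presented_scalerAr.

End PresentedAlgebra.

(** * Free algebras *)

Definition free_algebra (K : comNzRingType) (I : choiceType) : Type :=
  {malg K[{fmonom I}]}.

Section FreeAlgebra.
Variables (K : comNzRingType) (I : choiceType).

HB.instance Definition _ := GRing.Lalgebra.on (free_algebra K I).

Lemma malg_scalerAr (M : monomType) (c : K) (f g : {malg K[M]}) :
  c *: (f * g) = f * (c *: g).
Proof.
apply/malgP=> k; rewrite mcoeffZ mcoeffMl.
rewrite (mcoeffMlw k (fsubset_refl _) (msuppZ_le c g)) mulr_sumr.
apply: eq_bigr => k1 _; rewrite mulr_sumr; apply: eq_bigr => k2 _.
by rewrite mcoeffZ mulrnAr mulrCA.
Qed.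

Lemma free_scalerAr (c : K) (f g : free_algebra K I) :
  c *: (f * g) = f * (c *: g).
Proof. exact: malg_scalerAr. Qed.

HB.instance Definition _ :=
  GRing.Lalgebra_isAlgebra.Build K (free_algebra K I) free_scalerAr.

Definition free_gen (i : I) : free_algebra K I := << fmu i >>.

End FreeAlgebra.

(* Rewriting with in_cons directly on weyl_relators does not terminate in
   practice. *)
Lemma seq6_ind (T : eqType) (P : T -> Prop) (a b c d e f : T) :
  P a -> P b -> P c -> P d -> P e -> P f ->
  forall p, p \in [:: a; b; c; d; e; f] -> P p.
Proof.
move=> Pa Pb Pc Pd Pe Pf p; rewrite !inE.
by case/or4P=> [||| /or3P[]] /eqP->.
Qed.

(** * The alternative quantum Weyl algebra of rank two *)

Section AltQuantumWeyl.
Variables (K : fieldType) (q1 q2 lam : K).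

Local Notation F := (free_algebra K 'I_4).

Definition weyl_x1 : F := free_gen K (inord 0).
Definition weyl_y1 : F := free_gen K (inord 1).
Definition weyl_x2 : F := free_gen K (inord 2).
Definition weyl_y2 : F := free_gen K (inord 3).

Local Notation x1 := weyl_x1.
Local Notation y1 := weyl_y1.
Local Notation x2 := weyl_x2.
Local Notation y2 := weyl_y2.

Definition weyl_relators : seq F :=
  [:: x1 * x2 - lam *: (x2 * x1);
      x1 * y2 - lam^-1 *: (y2 * x1);
      y1 * y2 - lam *: (y2 * y1);
      y1 * x2 - lam^-1 *: (x2 * y1);
      x1 * y1 - q1 *: (y1 * x1) - 1;
      x2 * y2 - q2 *: (y2 * x2) - 1].

(* To see that the relations do not collapse the algebra, let it act on formal
   (possibly infinite) combinations \sum_(a, b) f a b y1^a y2^b, x1 and x2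
   annihilating 1.  The hypothesis lam != 0 matters: for lam = 0, where
   lam^-1 = 0 here, the relations force 1 = 0. *)
Definition weyl_qnum (q : K) (n : nat) : K := \sum_(i < n) q ^+ i.

Definition weyl_act_gen (i : 'I_4) (f : nat -> nat -> K) (a b : nat) : K :=
  match val i with
  | 0 => weyl_qnum q1 a.+1 * f a.+1 b
  | 1 => if a is a'.+1 then f a' b else 0
  | 2 => lam ^+ a * weyl_qnum q2 b.+1 * f a b.+1
  | _ => if b is b'.+1 then lam^-1 ^+ a * f a b' else 0
  end.

Definition weyl_act_word (w : seq 'I_4) (f : nat -> nat -> K) :=
  foldr weyl_act_gen f w.

Definition weyl_act (p : F) (f : nat -> nat -> K) (a b : nat) : K :=
  \sum_(w <- msupp p) p@_w * weyl_act_word w f a b.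

Lemma weyl_act_gen_sum (T : Type) (r : seq T) (c : T -> K)
    (v : T -> nat -> nat -> K) i a b :
  weyl_act_gen i (fun a b => \sum_(t <- r) c t * v t a b) a b =
  \sum_(t <- r) c t * weyl_act_gen i (v t) a b.
Proof.
case: i => [[|[|[|i]]] ?]; rewrite /weyl_act_gen /=.
- by rewrite mulr_sumr; apply: eq_bigr => t _; rewrite mulrCA.
- by case: a => [|a] //; rewrite big1 // => t _; rewrite mulr0.
- by rewrite mulr_sumr; apply: eq_bigr => t _; rewrite mulrCA.
- case: b => [|b]; first by rewrite big1 // => t _; rewrite mulr0.
  by rewrite mulr_sumr; apply: eq_bigr => t _; rewrite mulrCA.
Qed.

Lemma weyl_act_word_sum (T : Type) (r : seq T) (c : T -> K)
    (v : T -> nat -> nat -> K) w :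
  weyl_act_word w (fun a b => \sum_(t <- r) c t * v t a b) =
  fun a b => \sum_(t <- r) c t * weyl_act_word w (v t) a b.
Proof.
elim: w => //= i w ->; apply/funext => a; apply/funext => b.
exact: weyl_act_gen_sum.
Qed.

Lemma weyl_act_mmap p f a b :
  weyl_act p f a b =
    mmap idfun (fun w : {fmonom 'I_4} => weyl_act_word w f a b) p.
Proof. by []. Qed.

Lemma weyl_actM p r f : weyl_act (p * r) f = weyl_act p (weyl_act r f).
Proof.
apply/funext => a; apply/funext => b.
rewrite weyl_act_mmap malgME raddf_sum /=; apply: eq_bigr => k1 _.
rewrite raddf_sum /= /weyl_act weyl_act_word_sum mulr_sumr.
apply: eq_bigr => k2 _; rewrite mmapU mulrA; congr (_ * _).
by rewrite /weyl_act_word -foldr_cat -fmM.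
Qed.

Lemma weyl_act_gen1 i f : weyl_act (free_gen K i) f = weyl_act_gen i f.
Proof.
apply/funext => a; apply/funext => b.
by rewrite weyl_act_mmap mmapU mul1r /weyl_act_word fmU.
Qed.

Lemma weyl_act1 f : weyl_act 1 f = f.
Proof.
apply/funext => a; apply/funext => b.
by rewrite weyl_act_mmap mmapU mul1r /weyl_act_word fm1.
Qed.

Lemma weyl_actB p r f a b :
  weyl_act (p - r) f a b = weyl_act p f a b - weyl_act r f a b.
Proof. by rewrite !weyl_act_mmap raddfB. Qed.

Lemma weyl_actD p r f a b :
  weyl_act (p + r) f a b = weyl_act p f a b + weyl_act r f a b.
Proof. by rewrite !weyl_act_mmap raddfD. Qed.

Lemma weyl_actZ c p f a b : weyl_act (c *: p) f a b = c * weyl_act p f a b.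
Proof.
rewrite /weyl_act mulr_sumr (big_fset_incl _ (msuppZ_le c p)) /=.
  by apply: eq_bigr => w _; rewrite mcoeffZ mulrA.
by move=> w _ /mcoeff_outdom ->; rewrite mul0r.
Qed.

Lemma weyl_act0 f a b : weyl_act 0 f a b = 0.
Proof. by rewrite -(subrr 1) weyl_actB subrr. Qed.

Lemma weyl_qnumS q n : weyl_qnum q n.+1 = 1 + q * weyl_qnum q n.
Proof.
rewrite /weyl_qnum big_ord_recl mulr_sumr expr0; congr (_ + _).
by apply: eq_bigr => i _; rewrite exprS.
Qed.

Lemma weyl_act_gen2 (i j : 'I_4) f :
  weyl_act (free_gen K i * free_gen K j) f =
  weyl_act_gen i (weyl_act_gen j f).
Proof.
apply: etrans (weyl_actM _ _ _) _; apply: etrans (weyl_act_gen1 _ _) _.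
exact: (congr1 (weyl_act_gen i) (weyl_act_gen1 _ _)).
Qed.

Lemma weyl_act_rel (i j k l : 'I_4) c f a b :
  weyl_act (free_gen K i * free_gen K j - c *: (free_gen K k * free_gen K l))
    f a b =
  weyl_act_gen i (weyl_act_gen j f) a b -
    c * weyl_act_gen k (weyl_act_gen l f) a b.
Proof.
rewrite weyl_actB weyl_actZ.
by congr (_ - _ * _); exact: (congr1 (fun h => h a b) (weyl_act_gen2 _ _ _)).
Qed.

Lemma weyl_act_rel1 (i j k l : 'I_4) c f a b :
  weyl_act
    (free_gen K i * free_gen K j - c *: (free_gen K k * free_gen K l) - 1)
    f a b =
  weyl_act_gen i (weyl_act_gen j f) a b -
    c * weyl_act_gen k (weyl_act_gen l f) a b - f a b.
Proof. by rewrite weyl_actB weyl_act_rel weyl_act1. Qed.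

Lemma weyl_act_relators (lam_neq0 : lam != 0) p :
  p \in weyl_relators -> forall f a b, weyl_act p f a b = 0.
Proof.
move: p; pose P p := forall f a b, weyl_act p f a b = 0.
refine (@seq6_ind _ P _ _ _ _ _ _ _ _ _ _ _ _) => f a b.
1-4: rewrite [LHS]weyl_act_rel /weyl_act_gen /= !inordK //=.
5-6: rewrite [LHS]weyl_act_rel1 /weyl_act_gen /= !inordK //=.
- by rewrite exprS; ring.
- by case: b => [|b]; rewrite ?exprS; ring.
- case: a b => [|a] [|b]; rewrite ?exprS ?mulr0 ?subr0 //.
  by rewrite !mulrA divff // mul1r subrr.
- case: a => [|a]; rewrite ?mulr0 ?subr0 // exprS.
  by field.
- case: a => [|a]; last by rewrite (weyl_qnumS _ a.+1); ring.
  by rewrite /weyl_qnum big_ord1 expr0; ring.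
- have lamK : lam ^+ a * lam^-1 ^+ a = 1 by rewrite -exprMn divff ?expr1n.
  move: (lam ^+ a) (lam^-1 ^+ a) lamK => u v uv1.
  case: b => [|b]; first by rewrite /weyl_qnum big_ord1 expr0; ring: uv1.
  by rewrite (weyl_qnumS _ b.+1); ring: uv1.
Qed.

Lemma weyl_relators_proper (lam_neq0 : lam != 0) :
  ~ gen_ideal weyl_relators 1.
Proof.
move=> I1; suff act0 p : gen_ideal weyl_relators p ->
    forall f a b, weyl_act p f a b = 0.
  have /eqP := act0 1 I1 (fun _ _ => 1) 0 0.
  by rewrite weyl_act1 oner_eq0.
elim=> {p} [p /weyl_act_relators| | p r _ IHp _ IHr | h p _ IH | h p _ IH].
- exact.
- exact: weyl_act0.
- by move=> f a b; rewrite weyl_actD IHp IHr addr0.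
- move=> f a b; rewrite weyl_actM.
  have -> : weyl_act p f = weyl_act 0 f.
    by apply/funext => a'; apply/funext => b'; rewrite IH weyl_act0.
  by rewrite -weyl_actM mulr0 weyl_act0.
- by move=> f a b; rewrite weyl_actM IH.
Qed.

End AltQuantumWeyl.

Definition alt_quantum_weyl (K : fieldType) (q1 q2 lam : K)
    (lam_neq0 : lam != 0) : algType K :=
  presented_algebra (weyl_relators_proper (q1 := q1) (q2 := q2) lam_neq0).

(* Main.v *)
(* For any anticommuting family v_0, ..., v_(2n-1) with nonzero product over a
   torsion-free ring, A = sum_i v_i A_i has a square with commuting entries and
   tr (A^2k) = 0, so A^2n = 0 by Newton's identities; expanding A^2n gives the
   Amitsur-Levitzki identity of degree 2n for n x n matrices (Rosset).
   The Weyl algebra has a family of representations by matrices of size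
   n = l1 l2: with S the cyclic shift of order l and Q = diag (q^i), one mode acts
   by y = al S, x = S^-1 (s Q - al^-1 / (q - 1)), and the diagonal matrix of the
   powers of lam^-1 twists the second mode by the first.  Acting on the first
   basis vector, the normal monomials y1^a x1^c y2^b x2^d become linearly
   independent functions of the parameters, so the family separates points and
   the Weyl algebra inherits the identity of degree 2n.  Conversely one such
   representation is onto the matrix algebra, and the staircase of matrix units
   E_00, E_01, E_11, E_12, ... excludes monic identities of degree below 2n. *)
Require Import Defs.
From HB Require Import structures.
From mathcomp Require Import all_boot all_order all_fingroup all_algebra.
From mathcomp Require Import finmap boolp ring zify.
From mathcomp.multinomials Require Import monalg.
From mathcomp.real_closed Require Import mxtens.

Set Implicit Arguments.
Unset Strict Implicit.
Unset Printing Implicit Defensive.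

Import GRing.Theory Num.Theory.
Local Open Scope ring_scope.

(** * Newton's identities for a matrix with vanishing power traces *)

Definition torsion_free (V : zmodType) :=
  forall (x : V) n, x *+ n.+1 = 0 -> x = 0.

(** * The commutative subring generated by commuting elements *)

Section CommutingSubring.
Variables (R : nzRingType) (S : R -> Prop).

Inductive gen_subring : R -> Prop :=
  | gen_subring_mem x of S x : gen_subring x
  | gen_subring1 : gen_subring 1
  | gen_subringB x y of gen_subring x & gen_subring y : gen_subring (x - y)
  | gen_subringM x y of gen_subring x & gen_subring y : gen_subring (x * y).

Lemma gen_subring_comm x :
  (forall y, S y -> GRing.comm x y) -> forall y, gen_subring y -> GRing.comm x y.
Proof.
move=> xS y; elim=> {y} [y /xS//||y z _ xy _ xz|y z _ xy _ xz].
- exact: commr1.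
- exact: commrB.
- exact: commrM.
Qed.

Definition commuting := forall x y, S x -> S y -> GRing.comm x y.

(** The type carries the proof of commutation, so that a commutative ring structure can be attached
    to it. *)
Definition comm_subring_of (_ : commuting) := {x : R | `[< gen_subring x >]}.

Variable comS : commuting.
Local Notation C := (comm_subring_of comS).

Definition gen_subring_pred : {pred R} := fun x => `[< gen_subring x >].

Lemma gen_subring_closed : subring_closed gen_subring_pred.
Proof.
split=> [|x y /asboolP Sx /asboolP Sy|x y /asboolP Sx /asboolP Sy];
  apply/asboolP.
- exact: gen_subring1.
- exact: gen_subringB.
- exact: gen_subringM.
Qed.

HB.instance Definition _ :=
  GRing.isSubringClosed.Build R gen_subring_pred gen_subring_closed.
HB.instance Definition _ := SubChoice.copy C {x : R | gen_subring_pred x}.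
HB.instance Definition _ := [SubChoice_isSubNzRing of C by <:].

Lemma comm_subring_mulC : commutative (@GRing.mul C).
Proof.
move=> x y; apply: val_inj; rewrite !rmorphM /=.
apply: gen_subring_comm (asboolW (valP y)) => z Sz; apply/commr_sym.
by apply: gen_subring_comm (asboolW (valP x)) => t; apply: comS.
Qed.

HB.instance Definition _ :=
  GRing.PzRing_hasCommutativeMul.Build C comm_subring_mulC.

End CommutingSubring.

Section Newton.
Variable R : comNzRingType.

Lemma deriv_prod (I : finType) (f : I -> {poly R}) :
  (\prod_i f i)^`() = \sum_i (f i)^`() * \prod_(j | i != j) f j.
Proof.
(* On a duplicate-free list the condition [i != j] removes exactly one factor. *)
suff H (s : seq I) : uniq s ->
    (\prod_(i <- s) f i)^`() =
    \sum_(i <- s) (f i)^`() * \prod_(j <- s | i != j) f j.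
  by apply: H; apply: index_enum_uniq.
elim: s => [|x s IH /= /andP[xs us]]; first by rewrite !big_nil derivC.
rewrite !big_cons derivM IH // eqxx /=; congr (_ + _).
  congr (_ * _); rewrite [LHS]big_seq_cond [RHS]big_seq_cond; apply: eq_bigl => j.
  by case js: (j \in s) => //=; apply/esym/eqP => xj; rewrite xj js in xs.
rewrite mulr_sumr [LHS]big_seq [RHS]big_seq; apply: eq_bigr => i is_; rewrite big_cons.
by case: eqP => [ix|_]; [rewrite -ix is_ in xs | rewrite /= mulrCA].
Qed.

(** Jacobi's formula. In the Leibniz expansion the derivative of an entry of [char_poly_mx A] is 1
    on the diagonal and 0 elsewhere, so differentiating the [i]-th factor keeps only the
    permutations fixing [i]; they add up to the [i]-th diagonal cofactor. *)
Lemma deriv_char_poly n (A : 'M[R]_n) :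
  (char_poly A)^`() = \tr (\adj (char_poly_mx A)).
Proof.
rewrite /char_poly /determinant raddf_sum /=.
transitivity (\sum_(s : 'S_n) \sum_i (-1) ^+ s *
    ((char_poly_mx A i (s i))^`() * \prod_(j | i != j) char_poly_mx A j (s j))).
  apply: eq_bigr => s _; rewrite -mulr_sumr -deriv_prod.
  have -> : (-1) ^+ s = ((-1) ^+ s)%:P :> {poly R} by rewrite rmorph_sign.
  by rewrite !mul_polyC derivZ.
rewrite exchange_big; apply: eq_bigr => i _; rewrite mxE expand_cofactor /=.
rewrite [RHS]big_mkcond; apply: eq_bigr => s _.
rewrite !mxE derivB derivC subr0 derivMn derivX.
rewrite [i == _]eq_sym; case: eqP => /= _; last by rewrite mulr0n mul0r mulr0.
by rewrite mul1r.
Qed.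

Hypothesis tfR : torsion_free R.

(** Let [G] be the adjugate of X - A, read as a polynomial with matrix coefficients. Comparing
    coefficients in G (X - A) = p gives a recursion between the coefficients of [G], and their
    traces are the coefficients of p'. Descending from the top, the vanishing traces kill the lower
    coefficients of [p] and turn those of [G] into powers of [A]. *)
Lemma nilpotent_of_trace n (A : 'M[R]_n) :
  (forall k, \tr (A ^+ k.+1) = 0) -> A ^+ n = 0.
Proof.
case: n A => [|m] A trA; first exact: flatmx0.
have [phi [_ phiZ phiC phiE]] := mx_poly_ring_isom R m.
set p := char_poly A; set G := phi (\adj (char_poly_mx A)).
have trG k : \tr G`_k = p`_k.+1 *+ k.+1.
  rewrite -coef_deriv deriv_char_poly coef_sum.
  by apply: eq_bigr => i _; rewrite phiE.
have GE : G * ('X - A%:P) = map_poly scalar_mx p.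
  rewrite -phiZ -mul_adj_mx rmorphM /= -/G; congr (_ * _).
  by rewrite rmorphB phiC phiZ map_polyX.
have rec0 : - (G`_0 *m A) = (p`_0)%:M.
  have /(congr1 (fun q : {poly _} => q`_0)) := GE.
  by rewrite mulrBr coefB coefMX coefMC sub0r coef_map.
have recS k : G`_k - G`_k.+1 *m A = (p`_k.+1)%:M.
  have /(congr1 (fun q : {poly _} => q`_k.+1)) := GE.
  by rewrite mulrBr coefB coefMX coefMC coef_map.
have sp : size p = m.+2 by rewrite size_char_poly.
have pm : p`_m.+1 = 1.
  by have := char_poly_monic A; rewrite monicE lead_coefE sp => /eqP.
(* The degree bound on the adjugate follows from the recursion itself, descending from an arbitrary
   bound [N]: beyond [m] it only meets zero coefficients of [p]. *)
have G0 k : (m < k)%N -> G`_k = 0.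
  have [N sG] : exists N, (size G <= N)%N by exists (size G).
  move=> mk; have [Nk|kN] := leqP N k.
    by rewrite nth_default // (leq_trans sG).
  have {kN}: (k + (N - k) = N)%N by rewrite subnKC // ltnW.
  move: (N - k)%N => d; elim: d k mk => [|d IH] k mk kd.
    by rewrite nth_default // (leq_trans sG) // -kd addn0.
  have := recS k; rewrite (IH k.+1 (leqW mk)) ?addSnnS //.
  by rewrite mul0mx subr0 => ->; rewrite nth_default ?sp // raddf0.
have GA k : (k <= m)%N -> G`_(m - k) = A ^+ k.
  elim: k => [_|k IH km].
    have := recS m; rewrite (G0 m.+1) // mul0mx subr0 pm.
    by rewrite subn0 expr0.
  have := recS (m - k.+1)%N; rewrite -subSn // subSS IH ?(ltnW km) // => E.
  (* The trace equates the multiples m - k and m + 1 of one coefficient of [p]; their difference k +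
     1 is cancelled by torsion-freeness. *)
  have := congr1 mxtrace E; rewrite raddfB /= trG -subSn // subSS.
  rewrite mulmxE -exprSr trA subr0 mxtrace_scalar => pE.
  have p0 : p`_(m - k) = 0.
    apply: (@tfR _ k); apply: (addrI (p`_(m - k) *+ (m - k))).
    by rewrite addr0 -mulrnDr addnS subnK ?(ltnW km).
  by move: E; rewrite p0 raddf0 mulmxE -exprSr => /eqP; rewrite subr_eq0 => /eqP.
have := GA m (leqnn m); rewrite subnn => G0E.
move: rec0; rewrite G0E mulmxE -exprSr => E.
have := congr1 mxtrace E; rewrite raddfN /= trA oppr0 mxtrace_scalar => /esym p0.
by apply/eqP; rewrite -oppr_eq0 E (tfR p0) raddf0.
Qed.

End Newton.

(** * Anticommuting families *)

Definition anticomm (R : pzRingType) (x y : R) := x * y = - (y * x).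

Lemma anticommM2 (R : pzRingType) (x y z : R) :
  anticomm x y -> anticomm x z -> GRing.comm x (y * z).
Proof.
by move=> xy xz; rewrite /GRing.comm mulrA xy mulNr -mulrA xz mulrN opprK mulrA.
Qed.

(** Products of two entries commute with each other, so the square of [A] has entries in a
    commutative ring, where [nilpotent_of_trace] applies to it. *)
Lemma expr_anticomm_mx (R : nzRingType) n (A : 'M[R]_n) :
  torsion_free R ->
  (forall i j k l, anticomm (A i j) (A k l)) -> A ^+ n.*2 = 0.
Proof.
move=> tfR Aanti.
pose S x := exists i j k l, x = A i j * A k l.
have AS i j x : S x -> GRing.comm (A i j) x.
  by case=> [i1 [j1 [k1 [l1 ->]]]]; apply: anticommM2.
have comS : commuting S.
  move=> _ y [i [j [k [l ->]]]] Sy; apply: commr_sym.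
  by apply: commrM; apply: commr_sym; apply: AS.
pose C : comNzRingType := comm_subring_of comS.
have mkC i j : { x : comm_subring_of comS | val x = \sum_k A i k * A k j}.
  have P : `[< gen_subring S (\sum_k A i k * A k j) >].
    suff: \sum_k A i k * A k j \in gen_subring_pred S by [].
    apply: rpred_sum => k _.
    by apply/asboolP/gen_subring_mem; exists i, k, k, j.
  by exists (@exist R (fun x => `[< gen_subring S x >]) _ P).
pose B : 'M[C]_n := \matrix_(i, j) sval (mkC i j).
have BE : map_mx val B = A ^+ 2.
  by apply/matrixP => i j; rewrite expr2 !mxE; exact: svalP (mkC i j).
have BXE k : map_mx val (B ^+ k) = A ^+ k.*2.
  by rewrite -mul2n exprM -BE rmorphXn.
have tfC : torsion_free C.
  by move=> x k /(congr1 val); rewrite raddfMn => /tfR x0; apply: val_inj.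
have trA k : \tr (A ^+ k.+1.*2) = 0.
  have -> : A ^+ k.+1.*2 = A *m A *m A ^+ k.*2 by rewrite doubleS !exprS mulrA.
  have AX i j l m : GRing.comm (A i j) ((A ^+ k.*2) l m).
    rewrite -BXE mxE; apply: (@gen_subring_comm _ S); first exact: AS.
    exact: asboolW (valP ((B ^+ k) l m)).
  (* The trace equals its opposite: moving one entry of [A] cyclically to the other end passes one
     entry of [A], with a sign, and one entry of an even power, without. *)
  apply: (tfR _ 1%N); rewrite mulr2n; apply/eqP; rewrite addr_eq0; apply/eqP.
  transitivity (\sum_i \sum_j \sum_l A i j * A j l * (A ^+ k.*2) l i).
    apply: eq_bigr => i _; rewrite mxE exchange_big; apply: eq_bigr => l _.
    by rewrite mxE mulr_suml.
  rewrite -mulmxA !mulmxE (commrX _ (commr_refl A)) mulrA.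
  rewrite /mxtrace -sumrN [RHS](eq_bigr (fun j => \sum_l \sum_i
     - (A j l * (A ^+ k.*2) l i * A i j))); last first.
    move=> j _; rewrite mxE -sumrN exchange_big; apply: eq_bigr => i _.
    by rewrite mxE mulr_suml sumrN.
  rewrite exchange_big; apply: eq_bigr => j _.
  rewrite exchange_big; apply: eq_bigr => l _; apply: eq_bigr => i _.
  by rewrite (Aanti i j j l) mulNr -!mulrA (AX i j l i).
rewrite -BXE (nilpotent_of_trace tfC) ?raddf0 // => k; apply: val_inj.
rewrite raddf0 raddf_sum /=; apply: etrans (trA k); rewrite -BXE.
by apply: eq_bigr => i _; rewrite mxE.
Qed.

Lemma torsion_free_int : torsion_free int.
Proof. by move=> x n /eqP; rewrite mulrn_eq0 => /eqP. Qed.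

Lemma torsion_free_mx (V : zmodType) m n :
  torsion_free V -> torsion_free 'M[V]_(m, n).
Proof.
move=> tfV A k /matrixP A0; apply/matrixP => i j.
by rewrite mxE; apply: (tfV _ k); rewrite -mulmxnE A0 mxE.
Qed.

(** A matrix model of exterior generators, built one at a time: the old elements become diag(v, -v)
    and the new one is the matrix unit E_01, which anticommutes with them and has square zero. The
    full product then appears in position (0, 1). *)
Lemma anticomm_family N :
  exists (R : nzRingType) (v : nat -> R),
    [/\ torsion_free R, forall i j, anticomm (v i) (v j) &
        \prod_(i < N) v i != 0].
Proof.
elim: N => [|N [R [v [tfR v_anti v_neq0]]]].
  exists int, (fun=> 0); split; first exact: torsion_free_int.
    by move=> i j; rewrite /anticomm mulr0 oppr0.
  by rewrite big_ord0 oner_eq0.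
pose w k : 'M[R]_2 := \matrix_(i, j)
  if (k < N)%N then (if i == j then (if i == 0 then v k else - v k) else 0)
  else if [&& k == N, i == 0 & j == 1] then 1 else 0.
have mul2 (A B : 'M[R]_2) i j : (A * B) i j = A i 0 * B 0 j + A i 1 * B 1 j.
  rewrite mxE big_ord_recl big_ord1; congr (_ + A i _ * B _ j); exact: val_inj.
have ord2 (P : 'I_2 -> Prop) : P 0 -> P 1 -> forall i, P i.
  move=> P0 P1 [[|[|i]] lt_i] //.
    by rewrite (_ : Ordinal _ = 0) //; apply: val_inj.
  by rewrite (_ : Ordinal _ = 1) //; apply: val_inj.
have w_anti k l : anticomm (w k) (w l).
  apply/matrixP; apply: (ord2); apply: (ord2);
    rewrite [RHS]mxE !mul2 !mxE /= ?eqxx ?andbF ?andbT;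
    case: (k < N)%N; case: (l < N)%N; case: (k == N); case: (l == N) => /=;
    rewrite ?(mulr0, mul0r, addr0, add0r, mulr1, mul1r) ?oppr0 //;
    rewrite ?(mulNr, mulrN, opprK) //;
    exact: v_anti.
have wE k : (k <= N)%N ->
    (\prod_(i < k) w i) 0 0 = \prod_(i < k) v i /\ (\prod_(i < k) w i) 0 1 = 0.
  elim: k => [|k IH kN]; first by rewrite !big_ord0 !mxE.
  have [E0 E1] := IH (ltnW kN); rewrite !big_ord_recr /= !mul2 E0 E1 !mxE kN /=.
  by rewrite !(mulr0, mul0r, addr0).
exists 'M[R]_2, w; split=> //; first exact: torsion_free_mx.
rewrite big_ord_recr /=; apply/eqP => /matrixP/(_ 0 1).
have [E0 E1] := wE N (leqnn N).
rewrite mul2 E0 E1 !mxE ltnn !eqxx /= mulr1 mul0r addr0 => /eqP.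
by rewrite (negbTE v_neq0).
Qed.

Section AnticommWords.
Variables (R : nzRingType) (v : nat -> R).
Hypotheses (tfR : torsion_free R) (v_anti : forall i j, anticomm (v i) (v j)).

Local Notation vprod s := (\prod_(i <- s) v i).

Lemma vprod_comm i s : exists e : bool, v i * vprod s = (-1) ^+ e * (vprod s * v i).
Proof.
elim: s => [|j s [e IH]].
  by exists false; rewrite !big_nil mulr1 !mul1r.
exists (~~ e); rewrite !big_cons mulrA v_anti mulNr -!mulrA IH.
by rewrite !mulrA (commr_sign (v j) e) signrN !mulNr.
Qed.

(** Two equal letters can be brought together up to sign, and anticommutation of [v i] with itself
    makes twice its square zero. *)
Lemma vprod_nuniq s : ~~ uniq s -> vprod s = 0.
Proof.
elim: s => //= i s IH; rewrite negb_and negbK big_cons => /orP[|/IH->]; last first.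
  by rewrite mulr0.
case/splitPr => s1 s2; rewrite big_cat big_cons /= mulrA.
have [e ->] := vprod_comm i s1; rewrite -!mulrA [v i * (v i * _)]mulrA.
have -> : v i * v i = 0.
  by apply: (tfR (n := 1)); rewrite mulr2n {1}v_anti addNr.
by rewrite mul0r !mulr0.
Qed.

Lemma vprod_perm s t : perm_eq s t ->
  exists e : bool, vprod t = (-1) ^+ e * vprod s.
Proof.
elim: s t => [|i s IH] t.
  rewrite perm_sym => /perm_nilP ->.
  by exists false; rewrite mul1r.
move=> st; have it : i \in t by rewrite -(perm_mem st) mem_head.
case/splitPr: it st => t1 t2; rewrite perm_sym perm_catC /= perm_cons.
rewrite perm_catC perm_sym => /IH[e te].
have [e' i1] := vprod_comm i t1.
have {}i1 : vprod t1 * v i = (-1) ^+ e' * (v i * vprod t1).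
  by rewrite i1 mulrA -signr_addb addbb mul1r.
exists (e' (+) e); rewrite big_cat !big_cons /= mulrA i1 -!mulrA -big_cat te.
by rewrite signr_addb -!mulrA [v i * _]mulrA (commr_sign (v i) e) !mulrA.
Qed.

End AnticommWords.

(** * The Amitsur-Levitzki identity *)

Lemma prodrM_comm (R : pzSemiRingType) (I : Type) (s : seq I) (x y : I -> R) :
  (forall i j, GRing.comm (y i) (x j)) ->
  \prod_(i <- s) (x i * y i) = (\prod_(i <- s) x i) * \prod_(i <- s) y i.
Proof.
move=> yx; elim: s => [|i s IH]; first by rewrite !big_nil mulr1.
rewrite !big_cons IH !mulrA; congr (_ * _); rewrite -!mulrA; congr (_ * _).
by apply: commr_prod => j _; apply: yx.
Qed.

(** Used on the expansion of a power of a sum, whose terms are indexed by all functions. *)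
Lemma sum_perm_ffun (V : nmodType) n (F : {ffun 'I_n -> 'I_n} -> V) :
  (forall f : {ffun 'I_n -> 'I_n}, ~~ injectiveb f -> F f = 0) ->
  \sum_f F f = \sum_(s : 'S_n) F (pval s).
Proof.
move=> F0; rewrite (bigID (fun f : {ffun 'I_n -> 'I_n} => injectiveb f)) /=.
rewrite addrC big1 => [|f /F0//]; rewrite add0r.
rewrite (reindex (@pval _)) /=; last first.
  pose in_Sn := insubd (1%g : 'S_n).
  by exists in_Sn => /= f Uf; first apply: val_inj; apply: insubdK.
by apply: eq_bigl => s; rewrite (valP s).
Qed.

(** Integers are central even though [R] is noncommutative; this is why the identity is proved over
    [int] first. *)
Lemma comm_scalar_intr_mx (R : nzRingType) n (A : 'M[int]_n) (x : R) :
  GRing.comm (map_mx intr A) x%:M.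
Proof.
rewrite /GRing.comm -!mulmxE mul_scalar_mx -diag_const_mx mul_mx_diag.
by apply/matrixP => i j; rewrite !mxE commr_int.
Qed.

(* e s is the parity of s, but only e 1 matters for the identity to be monic. *)
Lemma amitsur_levitzki_int n :
  exists e : 'S_n.*2 -> bool, e 1%g = false /\
    forall a : 'I_n.*2 -> 'M[int]_n,
      \sum_s (-1) ^+ e s *: \prod_i a (s i) = 0.
Proof.
set N := n.*2; have [R [v [tfR v_anti v_neq0]]] := anticomm_family N.
pose w (f : 'I_N -> 'I_N) := \prod_i v (f i).
have wE f : w f = \prod_(i <- [seq val (f i) | i <- index_enum 'I_N]) v i.
  by rewrite big_map.
have sign_perm (s : 'S_N) : exists e : bool, w s == (-1) ^+ e * w id.
  rewrite !wE; suff /(vprod_perm v_anti)[e ->] :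
      perm_eq [seq val i | i <- index_enum 'I_N]
              [seq val (s i) | i <- index_enum 'I_N] by exists e.
  rewrite perm_sym.
  rewrite (map_comp val) perm_map //.
  apply: uniq_perm; rewrite ?(map_inj_uniq perm_inj) ?index_enum_uniq // => i.
  rewrite mem_index_enum; apply/mapP; exists (s^-1%g i); last by rewrite permKV.
  exact: mem_index_enum.
pose e (s : 'S_N) := if s == 1%g then false else xchoose (sign_perm s).
have eE (s : 'S_N) : w s = (-1) ^+ e s * w id.
  rewrite /e; case: eqP => [->|_]; last exact/eqP/(xchooseP (sign_perm s)).
  by rewrite mul1r; apply: eq_bigr => i _; rewrite perm1.
exists e; split=> [|a]; first by rewrite /e eqxx.
pose A i : 'M[R]_n := map_mx intr (a i).
(* The entries of [M] anticommute, so its power [N] vanishes; expanding that power gives the wanted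
   alternating sum times [w id]. *)
pose M := \sum_(i < N) (v i)%:M * A i.
have M0 : M ^+ N = 0.
  apply: expr_anticomm_mx => // i j k l.
  have ME i' j' : M i' j' = \sum_(m < N) v m * (a m i' j')%:~R.
    rewrite summxE; apply: eq_bigr => m _.
    by rewrite -mulmxE mul_scalar_mx !mxE.
  have := fun m m' => v_anti m m'.
  rewrite !ME /anticomm mulr_suml mulr_suml -sumrN => {}v_anti.
  under eq_bigr => m _ do rewrite mulr_sumr.
  under [RHS]eq_bigr => m _ do rewrite mulr_sumr -sumrN.
  rewrite exchange_big; apply: eq_bigr => m _; apply: eq_bigr => m' _.
  by rewrite !mulrzr !mulrzAl !mulrzAr v_anti !mulNrz -!mulrzA mulrC.
have : (\sum_s (-1) ^+ e s *: \prod_i A (s i)) * (w id)%:M = 0.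
  apply: (etrans _ M0); rewrite -[in RHS](card_ord N) -prodr_const bigA_distr_bigA /=.
  rewrite sum_perm_ffun => [|f /negP f_ninj].
    rewrite mulr_suml; apply: eq_bigr => s _; rewrite prodrM_comm => [|i j].
      have -> : \prod_i (v (pval s i))%:M = (w s)%:M :> 'M[R]_n.
        by rewrite /w rmorph_prod; apply: eq_bigr => i _; rewrite pvalE.
      have -> : \prod_i A (pval s i) = \prod_i A (s i).
        by apply: eq_bigr => i _; rewrite pvalE.
      have -> : \prod_i A (s i) = map_mx intr (\prod_i a (s i)).
        by rewrite rmorph_prod.
      rewrite eE rmorphM /= -!mulmxE -scalemxAl mulmxE -mulrA -mulmxE mul_scalar_mx.
      by congr (_ *: _); apply: comm_scalar_intr_mx.
    exact: comm_scalar_intr_mx.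
  rewrite prodrM_comm => [|i j]; last exact: comm_scalar_intr_mx.
  have -> : \prod_i (v (f i))%:M = (w f)%:M :> 'M[R]_n.
    by rewrite /w rmorph_prod.
  rewrite wE vprod_nuniq ?raddf0 ?mul0r // (map_comp val) map_inj_uniq //.
    apply/negP => f_uniq; apply: f_ninj; rewrite /injectiveb /dinjectiveb.
    rewrite (@perm_uniq _ _ [seq f i | i <- index_enum 'I_N]) // perm_map //.
    rewrite uniq_perm ?enum_uniq ?index_enum_uniq // => i.
    by rewrite mem_enum mem_index_enum.
  exact: val_inj.
move=> /matrixP T0; apply/matrixP => i j; move: (T0 i j).
set T := \sum_s _; set T' := \sum_s _.
have -> : T = map_mx intr T'.
  rewrite raddf_sum; apply: eq_bigr => s _ /=; rewrite map_mxZ rmorph_sign.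
  by rewrite rmorph_prod.
rewrite -mulmxE -diag_const_mx mul_mx_diag !mxE mulrzl.
(* By torsion-freeness, only the zero multiple of the nonzero element [w id] vanishes. *)
move: (T' i j) => [] k; first by case: k => // k /tfR w0; case/eqP: v_neq0.
rewrite NegzE mulrNz => /eqP; rewrite oppr_eq0 => /eqP/tfR w0.
by case/eqP: v_neq0.
Qed.

Lemma scaler_prod_mx (R : comNzRingType) n (I : finType) (c : I -> R)
    (A : I -> 'M[R]_n) :
  \prod_i (c i *: A i) = (\prod_i c i) *: \prod_i A i.
Proof.
rewrite -[RHS]mul_scalar_mx rmorph_prod mulmxE -prodrM_comm => [|i j].
  by apply: eq_bigr => i _; rewrite -mul_scalar_mx.
by rewrite /GRing.comm -!mulmxE scalar_mxC.
Qed.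

(** By multilinearity it suffices to substitute matrix units, and these are images of integer
    matrices. *)
Theorem amitsur_levitzki n :
  exists e : 'S_n.*2 -> bool, e 1%g = false /\
    forall (R : comNzRingType) (a : 'I_n.*2 -> 'M[R]_n),
      \sum_s (-1) ^+ e s *: \prod_i a (s i) = 0.
Proof.
have [e [e1 eP]] := amitsur_levitzki_int n; exists e; split=> // R a.
pose I := ('I_n * 'I_n)%type.
pose E (A : pzRingType) (i : I) : 'M[A]_n := delta_mx i.1 i.2.
have aE i : a i = \sum_(p : I) a i p.1 p.2 *: E R p.
  by rewrite [LHS]matrix_sum_delta pair_big.
have prodE (s : 'S_n.*2) : \prod_i a (s i) =
    \sum_(f : {ffun 'I_n.*2 -> I})
      (\prod_i a i (f i).1 (f i).2) *: \prod_i E R (f (s i)).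
  under eq_bigr => i _ do rewrite aE.
  rewrite bigA_distr_bigA /=.
  (* Composing [f] with [s] makes the scalar coefficient independent of [s], so that it factors out
     of the sum over permutations. *)
  rewrite (reindex (fun f : {ffun 'I_n.*2 -> I} => [ffun i => f (s i)])) /=.
    apply: eq_bigr => f _.
    rewrite [X in X *: _](reindex_perm s) -scaler_prod_mx.
    by apply: eq_bigr => i _; rewrite ffunE.
  exists (fun f : {ffun 'I_n.*2 -> I} => [ffun i => f (s^-1%g i)]) => f _;
    by apply/ffunP => i; rewrite !ffunE ?permK ?permKV.
under eq_bigr => s _ do rewrite prodE scaler_sumr.
rewrite exchange_big big1 // => f _.
under eq_bigr => s _ do rewrite scalerA mulrC -scalerA.
rewrite -scaler_sumr.
have /(congr1 (map_mx (intr : int -> R))) := eP (fun i => E int (f i)).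
rewrite raddf0 raddf_sum /= => E0.
apply: etrans (scaler0 _ (\prod_i a i (f i).1 (f i).2)); congr (_ *: _).
apply: etrans E0; apply: eq_bigr => s _.
rewrite map_mxZ rmorph_sign rmorph_prod; congr (_ *: _).
by apply: eq_bigr => i _; rewrite /= map_delta_mx.
Qed.

(** * Lower bound on the degree of identities of full matrix algebras *)

Lemma index_enumE (T : finType) : index_enum T = enum T.
Proof. by rewrite [index_enum T]unlock -enumT. Qed.

Section Staircase.
Variables (R : nzRingType) (m : nat).

Definition stair (t : nat) : 'M[R]_m.+1 :=
  delta_mx (inord t./2) (inord t.+1./2).

Definition stair_step : rel nat := [rel x y | x.+1./2 == y./2].

(** The bound keeps every index at most [m], where [inord] is faithful; consecutive units then
    compose exactly when [stair_step] holds. *)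
Lemma prod_stair x t : all (fun y => y < m.+1.*2.-1)%N (x :: t) ->
  \prod_(y <- x :: t) stair y =
  if path stair_step x t then delta_mx (inord x./2) (inord (last x t).+1./2)
  else 0.
Proof.
elim: t x => [|y t IH] x /andP[xm tm]; first by rewrite big_seq1.
rewrite big_cons (IH y tm) /=; case: (path _ y t); last by rewrite andbF mulr0.
have -> : stair_step x y = (inord x.+1./2 == inord y./2 :> 'I_m.+1).
  by rewrite -val_eqE /= !inordK //; move: tm xm => /= /andP[]; lia.
by rewrite andbT -mulmxE mul_delta_mx_cond; case: eqP.
Qed.

Lemma stair_step_sorted s : sorted stair_step s -> sorted leq s.
Proof. by apply: sub_sorted => x y /= /eqP; lia. Qed.

(** A nonzero product has a composable word of indices, and composable words are nondecreasing; the
    only nondecreasing rearrangement of 0, ..., d - 1 is the trivial one. *)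
Lemma prod_stair_perm d (u : 'S_d) : (d < m.+1.*2)%N ->
  (\prod_i stair (u i) != 0) = (u == 1%g).
Proof.
move=> dm; have -> : \prod_i stair (u i) =
    \prod_(x <- [seq val (u i) | i <- enum 'I_d]) stair x.
  by rewrite big_map -index_enumE.
have small (v : 'S_d) :
    all (fun y => y < m.+1.*2.-1)%N [seq val (v i) | i <- enum 'I_d].
  by apply/allP => _ /mapP[i _ ->]; have := ltn_ord (v i); rewrite /=; lia.
have id_enum : [seq val ((1%g : 'S_d) i) | i <- enum 'I_d] = iota 0 d.
  by rewrite -val_enum_ord; apply: eq_map => i; rewrite perm1.
apply/idP/eqP => [|->]; last first.
  have := small 1%g; rewrite id_enum; case: (d) => [|k] Ak.
    by rewrite big_nil oner_eq0.
  rewrite (prod_stair Ak) ifT; last first.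
    suff Hp x : path stair_step x (iota x.+1 k) by apply: Hp.
    by elim: k x {Ak} => //= k IH x; rewrite IH andbT; apply/eqP.
  apply/eqP => /matrixP/(_ (inord 0) (inord (last 0%N (iota 1 k)).+1./2))/eqP.
  by rewrite !mxE !eqxx oner_eq0.
have := small u; case E: [seq _ | _ <- _] => [|x t] xt.
  move=> _; apply/permP => i; have : i \in enum 'I_d by rewrite mem_enum.
  by case: (enum _) E.
rewrite (prod_stair xt); case: ifP => [|_]; last by rewrite eqxx.
move=> /(@stair_step_sorted (x :: t)) st _.
have {E st} E : [seq val (u i) | i <- enum 'I_d] = iota 0 d.
  apply: (sorted_eq leq_trans anti_leq); rewrite ?E ?iota_sorted // -E.
  rewrite -val_enum_ord (map_comp val) perm_map //.
  apply: uniq_perm; rewrite ?(map_inj_uniq perm_inj) ?enum_uniq // => i.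
  rewrite mem_enum; apply/mapP; exists (u^-1%g i); last by rewrite permKV.
  by rewrite mem_enum.
apply/permP => i; apply: val_inj; move: E; rewrite -id_enum.
by move/eq_in_map => /(_ i) ->; rewrite ?mem_enum.
Qed.

End Staircase.

(** Substituting the staircase permuted by the inverse of [s0] kills every term except the one at
    [s0], whose coefficient is 1. *)
Lemma full_mx_identity_degree (R : comNzRingType) n d (c : 'S_d -> R) :
  (0 < n)%N -> (exists s, c s = 1) ->
  (forall a : 'I_d -> 'M[R]_n, \sum_s c s *: \prod_i a (s i) = 0) ->
  (n.*2 <= d)%N.
Proof.
case: n => // m _ [s0 cs0] cP; rewrite leqNgt; apply/negP => dm.
have := cP (fun i => stair R m ((s0^-1)%g i)).
have stair_prod (s : 'S_d) : \prod_i stair R m (s0^-1%g (s i)) =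
    \prod_i stair R m ((s * s0^-1)%g i) by apply: eq_bigr => i _; rewrite permM.
rewrite (bigD1 s0) //= [X in _ + X]big1 => [|s ss0].
  rewrite addr0 cs0 scale1r stair_prod; apply/eqP.
  by rewrite prod_stair_perm // mulgV.
have := prod_stair_perm R (s * s0^-1)%g dm.
by rewrite -eq_mulgV1 (negbTE ss0) stair_prod => /negbFE/eqP ->; rewrite scaler0.
Qed.

(** * Homomorphisms out of presented algebras *)

Section FreeLift.
Variables (K : comNzRingType) (I : choiceType) (B : algType K) (g : I -> B).

Definition word_eval (w : {fmonom I}) : B := \prod_(i <- w) g i.

Lemma word_eval_mmorphism : mmorphism word_eval.
Proof.
by split=> [w1 w2|]; rewrite /word_eval ?fmM ?big_cat // fm1 big_nil.
Qed.

HB.instance Definition _ :=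
  monalg.isMultiplicative.Build {fmonom I} B word_eval word_eval_mmorphism.

Definition free_lift (p : free_algebra K I) : B := mmap (in_alg B) word_eval p.

Lemma free_lift_zmod_morphism : zmod_morphism free_lift.
Proof. by move=> p r; rewrite /free_lift raddfB. Qed.

Lemma free_lift_monoid_morphism : monoid_morphism free_lift.
Proof.
have [M1 M2] : multiplicative free_lift.
  apply: commr_mmap_is_multiplicative => p m m'.
  by rewrite /GRing.comm mulr_algl mulr_algr.
by split.
Qed.

Lemma free_liftZ c p : free_lift (c *: p) = c *: free_lift p.
Proof. by rewrite /free_lift mmapZ mulr_algl. Qed.

HB.instance Definition _ := GRing.isZmodMorphism.Build _ _ free_lift
  free_lift_zmod_morphism.
HB.instance Definition _ := GRing.isMonoidMorphism.Build _ _ free_lift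
  free_lift_monoid_morphism.

Lemma free_lift_rel p r c s t :
  free_lift (p * r - c *: (s * t)) =
  free_lift p * free_lift r - c *: (free_lift s * free_lift t).
Proof. by rewrite raddfB /= free_liftZ !rmorphM. Qed.

Lemma free_lift_rel1 p r c s t :
  free_lift (p * r - c *: (s * t) - 1) =
  free_lift p * free_lift r - c *: (free_lift s * free_lift t) - 1.
Proof. by rewrite raddfB /= free_lift_rel rmorph1. Qed.

Lemma free_lift_gen i : free_lift (free_gen K i) = g i.
Proof. by rewrite /free_lift mmapU /= scale1r mul1r /word_eval fmU big_seq1. Qed.

Variables (rels : seq (free_algebra K I)) (proper : ~ gen_ideal rels 1).
Local Notation A := (presented_algebra proper).

(** Evaluation kills the ideal as soon as it kills the relators, so its value on a representative
    depends only on the class. *)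
Lemma presented_lift : {in rels, forall p, free_lift p = 0} ->
  exists rho : {lrmorphism A -> B},
    forall i, rho (presented_pi proper (free_gen K i)) = g i.
Proof.
move=> rels0; have ideal0 p : gen_ideal rels p -> free_lift p = 0.
  elim=> {p} [p /rels0||p r _ p0 _ r0|h p _ p0|h p _ p0] //.
  - exact: raddf0.
  - by rewrite raddfD /= p0 r0 addr0.
  - by rewrite rmorphM /= p0 mulr0.
  - by rewrite rmorphM /= p0 mul0r.
pose rho (x : A) := free_lift (presented_repr x).
have rhoE p : rho (presented_pi proper p) = free_lift p.
  by apply/eqP; rewrite -subr_eq0 -raddfB /= ideal0 //; apply: presented_reprP.
have rho_pi (P : A -> Prop) : (forall p, P (presented_pi proper p)) -> forall x, P x.
  by move=> Ppi x; rewrite -(presented_reprK x).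
have rho_zmod : zmod_morphism rho.
  apply: (rho_pi) => p; apply: (rho_pi) => r.
  by rewrite -raddfB !rhoE raddfB.
have rho_monoid : monoid_morphism rho.
  split; first by rewrite -[1]/(presented_pi proper 1) rhoE rmorph1.
  apply: (rho_pi) => p; apply: (rho_pi) => r.
  by rewrite -rmorphM !rhoE rmorphM.
have rho_scalable : scalable rho.
  by move=> c; apply: (rho_pi) => p; rewrite -linearZ !rhoE free_liftZ.
pose rhoZ := GRing.isZmodMorphism.Build _ _ rho rho_zmod.
pose rhoM := GRing.isMonoidMorphism.Build _ _ rho rho_monoid.
pose rhoS := GRing.isScalable.Build _ _ _ _ rho rho_scalable.
pose rhoR : {lrmorphism A -> B} := HB.pack rho rhoZ rhoM rhoS.
by exists rhoR => i; rewrite /= rhoE free_lift_gen.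
Qed.

End FreeLift.

Lemma presented_free_ind (K : comNzRingType) (I : choiceType)
    (rels : seq (free_algebra K I)) (proper : ~ gen_ideal rels 1)
    (P : presented_algebra proper -> Prop) :
  P 1 -> (forall x y, P x -> P y -> P (x + y)) -> (forall c x, P x -> P (c *: x)) ->
  (forall i x, P x -> P (presented_pi proper (free_gen K i) * x)) ->
  forall x, P x.
Proof.
move=> P1 PD PZ Pgen x; rewrite -(presented_reprK x).
move: (presented_repr x) => p {x}; rewrite [p]monalgE.
have P0 : P 0 by rewrite -(scale0r 1); apply: PZ.
rewrite raddf_sum /=; elim/big_ind: _ => // w _.
have -> : << p@_w *g w >> = p@_w *: (<< w >> : free_algebra K I).
  by apply/malgP => k; rewrite mcoeffZ !mcoeffU mulr_natr.
rewrite presented_piZ; apply: (PZ); move: w => [] s {p}.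
elim: s => [|i s IH].
  have -> : << FMonom [::] >> = 1 :> free_algebra K I.
    by congr << _ >>; apply: val_inj; apply: esym fm1.
  by rewrite rmorph1.
have -> : << FMonom (i :: s) >> = free_gen K i * << FMonom s >>.
  apply: etrans (esym (fgmulUU _ _ _ _)); rewrite mulr1.
  by congr << _ >>; apply: val_inj; apply: esym; apply: etrans (fmM _ _) _; rewrite fmU.
by rewrite rmorphM; apply: Pgen.
Qed.

(** * Normal forms *)

Section QCommutation.
Variables (K : fieldType) (A : algType K).
Implicit Types (x y : A) (c q : K).

Lemma qcommX c x y n : x * y = c *: (y * x) -> x * y ^+ n = c ^+ n *: (y ^+ n * x).
Proof.
move=> xy; elim: n => [|n IH]; first by rewrite !expr0 mul1r mulr1 scale1r.
rewrite [in LHS]exprSr mulrA IH -scalerAl -[_ * x * y]mulrA xy -scalerAr scalerA.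
by rewrite mulrA -!exprSr.
Qed.

Lemma qcomm_inv c x y : c != 0 -> x * y = c *: (y * x) -> y * x = c^-1 *: (x * y).
Proof. by move=> c0 ->; rewrite scalerA mulVf // scale1r. Qed.

Lemma qweylX q x y n : x * y - q *: (y * x) - 1 = 0 ->
  x * y ^+ n = q ^+ n *: (y ^+ n * x) + weyl_qnum q n *: y ^+ n.-1.
Proof.
move=> /eqP; rewrite -addrA -opprD subr_eq0 => /eqP xy.
elim: n => [|n IH].
  by rewrite !expr0 mul1r mulr1 scale1r /weyl_qnum big_ord0 scale0r addr0.
rewrite [in LHS]exprSr mulrA IH mulrDl -!scalerAl -[_ * x * y]mulrA xy mulrDr.
rewrite mulr1 -scalerAr scalerDr scalerA mulrA -!exprSr -addrA; congr (_ + _).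
rewrite /weyl_qnum big_ord_recr /= addrC scalerDl; congr (_ + _).
(* At [n = 0] the truncated exponent [n.-1] is harmless, its coefficient being an empty sum. *)
by case: n {IH} => [|n]; rewrite ?big_ord0 ?scale0r //= -?exprSr.
Qed.

End QCommutation.

Section NormalForm.
Variables (K : fieldType) (A : algType K) (q1 q2 lam : K) (x1 y1 x2 y2 : A).
Definition normal_mono (t : (nat * nat) * (nat * nat)) : A :=
  y1 ^+ t.1.1 * x1 ^+ t.1.2 * (y2 ^+ t.2.1 * x2 ^+ t.2.2).

(** Terms may repeat in the list, so addition is concatenation; [normal_span_box] collects them
    afterwards. *)
Definition normal_span (z : A) :=
  exists s : seq (K * ((nat * nat) * (nat * nat))),
    z = \sum_(p <- s) p.1 *: normal_mono p.2.

Lemma normal_spanD z w : normal_span z -> normal_span w -> normal_span (z + w).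
Proof. by case=> [s ->] [s' ->]; exists (s ++ s'); rewrite big_cat. Qed.

Lemma normal_spanZ c z : normal_span z -> normal_span (c *: z).
Proof.
case=> [s ->]; exists [seq (c * p.1, p.2) | p <- s].
by rewrite big_map scaler_sumr; apply: eq_bigr => p _; rewrite scalerA.
Qed.

Lemma normal_span_mono t : normal_span (normal_mono t).
Proof. by exists [:: (1, t)]; rewrite big_seq1 scale1r. Qed.

Lemma normal_span1 : normal_span 1.
Proof.
by have := normal_span_mono ((0, 0), (0, 0))%N; rewrite /normal_mono !expr0 !mulr1.
Qed.

Lemma normal_spanMl g : (forall t, normal_span (g * normal_mono t)) ->
  forall z, normal_span z -> normal_span (g * z).
Proof.
move=> gm _ [s ->]; rewrite mulr_sumr; elim/big_ind: _ => [||p _].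
- by exists [::]; rewrite big_nil.
- exact: normal_spanD.
- by rewrite -scalerAr; apply: normal_spanZ.
Qed.

Lemma normal_span_box z : normal_span z ->
  exists N (k : ('I_N * 'I_N) * ('I_N * 'I_N) -> K),
    z = \sum_t k t *:
      normal_mono ((val t.1.1, val t.1.2), (val t.2.1, val t.2.2)).
Proof.
case=> s ->.
have [N sN] : exists N, forall p, p \in s ->
    [/\ p.2.1.1 < N, p.2.1.2 < N, p.2.2.1 < N & p.2.2.2 < N]%N.
  elim: s => [|[k [[a c] [b d]]] s [N sN]]; first by exists 0%N.
  exists (N + a + c + b + d).+1 => r; rewrite inE => /predU1P[->|/sN].
    by split; rewrite /=; lia.
  by case: r => [k' [[a' c'] [b' d']]] /= [? ? ? ?]; split; lia.
pose vals (t : ('I_N * 'I_N) * ('I_N * 'I_N)) :=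
  ((val t.1.1, val t.1.2), (val t.2.1, val t.2.2)).
exists N, (fun t => \sum_(p <- s | p.2 == vals t) p.1).
under [RHS]eq_bigr => t _ do rewrite scaler_suml big_mkcond.
rewrite exchange_big big_seq [RHS]big_seq; apply: eq_bigr => -[c t] ps.
have [/= l1 l2 l3 l4] := sN _ ps.
pose t0 := ((Ordinal l1, Ordinal l2), (Ordinal l3, Ordinal l4)).
have vt0 : vals t0 = t by rewrite /vals /t0 /=; case: (t) => [[? ?] [? ?]].
rewrite (bigD1 t0) //= -/(vals t0) vt0 eqxx big1 ?addr0 // => t' nt'.
case: eqP => // tE; case/eqP: nt'; move: tE; rewrite -vt0.
case: t' => [[? ?] [? ?]] /= [E1 E2 E3 E4].
by congr (_, _, (_, _)); apply: val_inj.
Qed.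

Hypothesis lam_neq0 : lam != 0.
Hypotheses
  (x1x2 : x1 * x2 = lam *: (x2 * x1)) (x1y2 : x1 * y2 = lam^-1 *: (y2 * x1))
  (y1y2 : y1 * y2 = lam *: (y2 * y1)) (y1x2 : y1 * x2 = lam^-1 *: (x2 * y1))
  (x1y1 : x1 * y1 - q1 *: (y1 * x1) - 1 = 0)
  (x2y2 : x2 * y2 - q2 *: (y2 * x2) - 1 = 0).

Lemma normal_span_y1 z : normal_span z -> normal_span (y1 * z).
Proof.
apply: normal_spanMl => -[[a c] [b d]].
by have := normal_span_mono ((a.+1, c), (b, d)); rewrite /normal_mono exprS !mulrA.
Qed.

Lemma normal_span_x1 z : normal_span z -> normal_span (x1 * z).
Proof.
apply: normal_spanMl => -[[a c] [b d]].
rewrite /normal_mono /= !mulrA (qweylX _ x1y1) !mulrDl -!scalerAl.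
apply: normal_spanD; apply: normal_spanZ.
  have := normal_span_mono ((a, c.+1), (b, d)).
  by rewrite /normal_mono /= exprS !mulrA.
by have := normal_span_mono ((a.-1, c), (b, d)); rewrite /normal_mono /= !mulrA.
Qed.

Lemma normal_span_y2 z : normal_span z -> normal_span (y2 * z).
Proof.
apply: normal_spanMl => -[[a c] [b d]].
have y2y1 := qcomm_inv lam_neq0 y1y2.
have y2x1 := qcomm_inv (invr_neq0 lam_neq0) x1y2.
rewrite /normal_mono /= !mulrA (qcommX a y2y1) -!scalerAl -[_ * y2 * _]mulrA.
rewrite (qcommX c y2x1) -!scalerAr -!scalerAl; do 2!apply: normal_spanZ.
have := normal_span_mono ((a, c), (b.+1, d)).
by rewrite /normal_mono /= exprS !mulrA.
Qed.

(** Mode 2 crosses the powers of mode 1 up to powers of [lam]; then [qweylX] moves [x2] past the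
    powers of [y2] at the cost of a second monomial. *)
Lemma normal_span_x2 z : normal_span z -> normal_span (x2 * z).
Proof.
apply: normal_spanMl => -[[a c] [b d]].
have x2x1 := qcomm_inv lam_neq0 x1x2.
have x2y1 := qcomm_inv (invr_neq0 lam_neq0) y1x2.
rewrite /normal_mono /= !mulrA (qcommX a x2y1) -!scalerAl -[_ * x2 * _]mulrA.
rewrite (qcommX c x2x1) -!scalerAr -!scalerAl; do 2!apply: normal_spanZ.
rewrite mulrA -[_ * x2 * _]mulrA (qweylX _ x2y2) mulrDr mulrDl.
rewrite -!scalerAr -!scalerAl; apply: normal_spanD; apply: normal_spanZ.
  have := normal_span_mono ((a, c), (b, d.+1)).
  by rewrite /normal_mono /= exprS !mulrA.
by have := normal_span_mono ((a, c), (b.-1, d)); rewrite /normal_mono /= !mulrA.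
Qed.

End NormalForm.

(** * Cyclic representations of one mode *)

Section CyclicShift.
Variables (K : fieldType) (m : nat).
Local Notation l := m.+1.

Definition shift_mx : 'M[K]_l := \matrix_(i, j) (i == ordS j)%:R.
Definition unshift_mx : 'M[K]_l := \matrix_(i, j) (ordS i == j)%:R.
Definition geom_mx (r : K) : 'M[K]_l := diag_mx (\row_i r ^+ i).

Local Notation S := shift_mx.
Local Notation T := unshift_mx.

Lemma unshiftK : T * S = 1.
Proof.
apply/matrixP => i j; rewrite !mxE (bigD1 (ordS i)) //= big1 => [|k nk].
  by rewrite !mxE eqxx mul1r addr0 (inj_eq (@ordS_inj _)).
by rewrite !mxE eq_sym (negbTE nk) mul0r.
Qed.

Lemma shiftK : S * T = 1.
Proof. exact: mulmx1C unshiftK. Qed.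

Lemma geom_mxM r s : geom_mx r * geom_mx s = geom_mx (r * s).
Proof.
rewrite -mulmxE mulmx_diag; congr diag_mx; apply/rowP => i.
by rewrite !mxE exprMn.
Qed.

Lemma geom_mx1 : geom_mx 1 = 1.
Proof.
by apply/matrixP => i j; rewrite !mxE expr1n.
Qed.

(** The hypothesis on [r] serves the wrap-around from the last index to 0. *)
Lemma geom_shift r : r ^+ l = 1 -> geom_mx r * S = r *: (S * geom_mx r).
Proof.
move=> rl; apply/matrixP => i j; rewrite -!mulmxE mul_diag_mx mul_mx_diag !mxE.
case: eqP => [->|_]; last by rewrite mul0r !mulr0.
by rewrite mul1r mulr1 /= expr_mod // exprS.
Qed.

Lemma unshift_geom r : r ^+ l = 1 -> T * geom_mx r = r *: (geom_mx r * T).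
Proof.
move=> /geom_shift rS; rewrite -[LHS]mulr1 -shiftK mulrA -[T * _ * S]mulrA rS.
by rewrite -!mulmxE -scalemxAr -scalemxAl !mulmxE !mulrA unshiftK mul1r.
Qed.

Variable (q : K).
Hypothesis ql : q ^+ l = 1.
Variables (al s : K).
Local Notation Q := (geom_mx q).
Local Notation b := (al^-1 / (q - 1)).

Definition weyl_y : 'M[K]_l := al *: S.
(** In xy - q yx the [Q] terms cancel for every [s], and [b] is the constant with al b (q - 1) = 1.
    Hence [al] and [s] are free parameters. *)
Definition weyl_x : 'M[K]_l := T * (s *: Q - b%:M).

Lemma weyl_yx : weyl_y * weyl_x = al *: (s *: Q - b%:M).
Proof.
by rewrite /weyl_y /weyl_x -mulmxE -scalemxAl mulmxE mulrA shiftK mul1r.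
Qed.

Lemma weyl_xy : weyl_x * weyl_y = al *: ((s * q) *: Q - b%:M).
Proof.
rewrite /weyl_y /weyl_x -!mulmxE -scalemxAr; congr (_ *: _).
rewrite !mulmxE mulrBr mulrBl -!mulmxE -scalemxAr -scalemxAl mul_mx_scalar.
rewrite -scalemxAl !mulmxE unshiftK -mulrA geom_shift // -mulmxE -scalemxAr.
by rewrite mulmxE mulrA unshiftK mul1r scalerA scalemx1.
Qed.

(** Here [b] cancels instead, so the commutator recovers [geom_mx q] from the two generators; this
    serves surjectivity. *)
Lemma weyl_comm : weyl_x * weyl_y - weyl_y * weyl_x = (al * s * (q - 1)) *: Q.
Proof.
rewrite weyl_xy weyl_yx -scalerBr opprB addrA subrK -scalerBl scalerA.
by congr (_ *: _); ring.
Qed.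

Lemma weyl_rel : al != 0 -> q != 1 ->
  weyl_x * weyl_y - q *: (weyl_y * weyl_x) - 1 = 0.
Proof.
move=> al0 q1; rewrite weyl_xy weyl_yx; apply/matrixP => i j; rewrite !mxE.
have q10 : q - 1 != 0 by rewrite subr_eq0.
have -> : (al * (s * q * (q ^+ i *+ (i == j)) - b *+ (i == j)) -
  q * (al * (s * (q ^+ i *+ (i == j)) - b *+ (i == j))))
  = (al * (b * (q - 1))) *+ (i == j).
  by case: eqP => _; rewrite ?mulr0n ?mulr1n; ring.
by rewrite divfK // divff // subrr.
Qed.

Lemma weyl_y_geom r : r ^+ l = 1 -> geom_mx r * weyl_y = r *: (weyl_y * geom_mx r).
Proof.
move=> rl; rewrite /weyl_y -!mulmxE -scalemxAr -scalemxAl mulmxE geom_shift //.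
by rewrite scalerA mulrC -scalerA.
Qed.

Lemma weyl_x_geom r : r ^+ l = 1 -> weyl_x * geom_mx r = r *: (geom_mx r * weyl_x).
Proof.
move=> rl; have QC : (s *: Q - b%:M) * geom_mx r = geom_mx r * (s *: Q - b%:M).
  rewrite mulrBl mulrBr -!mulmxE -scalemxAl -scalemxAr scalar_mxC !mulmxE.
  by rewrite !geom_mxM mulrC.
by rewrite /weyl_x -mulrA QC mulrA unshift_geom // -!mulmxE -!scalemxAl !mulmxE mulrA.
Qed.

(** [Q] acts on the [i]-th unshift of the first basis vector by the power [i] of the inverse of [q],
    so each application of [weyl_x] contributes one factor of the product. *)
Definition weyl_coef (u : nat * nat) : K :=
  al ^+ u.1 * \prod_(i < u.2) (s * q^-1 ^+ i - b).

(** A row fixed by both shifts reads off the scalar in front of a basis vector without tracking its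
    position modulo [l]. *)
Definition ones : 'rV[K]_l := const_mx 1.
Definition base_col : 'cV[K]_l := delta_mx 0 0.

Lemma geom_e0 r : geom_mx r *m base_col = base_col.
Proof.
apply/matrixP => i j; rewrite mul_diag_mx !mxE.
by case: eqP => [->|_]; rewrite ?expr0 ?mul1r ?mulr0.
Qed.

Lemma ones_shift : ones *m S = ones.
Proof.
apply/matrixP => i j; rewrite !mxE (bigD1 (ordS j)) //= big1 => [|k nk].
  by rewrite !mxE eqxx mulr1 addr0.
by rewrite !mxE (negbTE nk) mulr0.
Qed.

Lemma ones_unshift : ones *m T = ones.
Proof. by rewrite -[in LHS]ones_shift -mulmxA mulmxE shiftK mulmx1. Qed.

Lemma ones_weyl_coef u :
  ones *m (weyl_y ^+ u.1 * weyl_x ^+ u.2) *m base_col =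
  weyl_coef u *: (ones *m base_col).
Proof.
case: u => a c; rewrite /weyl_coef /=.
have q0 : q != 0.
  by apply/eqP => q0; move/eqP: ql; rewrite q0 expr0n /= eq_sym oner_eq0.
have onesY : ones *m weyl_y ^+ a = al ^+ a *: ones.
  elim: a => [|a IH]; first by rewrite !expr0 mulmx1 scale1r.
  rewrite !exprSr -mulmxE mulmxA IH -scalemxAl /weyl_y -scalemxAr ones_shift.
  by rewrite scalerA.
have QT i : Q * T ^+ i = q^-1 ^+ i *: (T ^+ i * Q).
  elim: i => [|i IH]; first by rewrite !expr0 mul1r mulr1 scale1r.
  have QT : Q * T = q^-1 *: (T * Q) by rewrite unshift_geom // scalerA mulVf // scale1r.
  rewrite exprSr mulrA IH -!mulmxE -scalemxAl mulmxE -mulrA QT.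
  by rewrite -mulmxE -scalemxAr scalerA !mulmxE mulrA -exprSr.
have xE : weyl_x ^+ c *m base_col =
    (\prod_(i < c) (s * q^-1 ^+ i - b)) *: (T ^+ c *m base_col).
  elim: c => [|c IH]; first by rewrite !expr0 big_ord0 scale1r.
  rewrite exprS -mulmxE -mulmxA IH -scalemxAr big_ord_recr /= -scalerA.
  congr (_ *: _); rewrite /weyl_x -mulmxE -!mulmxA mulmxBl -scalemxAl mulmxA.
  rewrite mulmxE QT -scalemxAl -mulmxE -mulmxA geom_e0 scalerA mul_scalar_mx.
  by rewrite -scalerBl -scalemxAr mulmxA mulmxE -exprS.
have onesT : ones *m T ^+ c = ones.
  elim: c {xE} => [|c IH]; first by rewrite expr0 mulmx1.
  by rewrite exprSr -mulmxE mulmxA IH ones_unshift.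
rewrite -mulmxE mulmxA onesY -!mulmxA xE -scalemxAl -scalemxAr scalerA.
by rewrite mulmxA onesT.
Qed.

End CyclicShift.

(** * Generation of the matrix algebra and independence *)

Section FullMatrixAlgebra.
Variables (K : fieldType) (n : nat) (P : 'M[K]_n -> Prop).

Definition unital_subalgebra :=
  [/\ P 1, forall A B, P A -> P B -> P (A + B), forall c A, P A -> P (c *: A) &
      forall A B, P A -> P B -> P (A * B)].

Hypothesis Palg : unital_subalgebra.

Lemma unital_subalgebra_sum (I : finType) (Q : pred I) F :
  (forall i, P (F i)) -> P (\sum_(i | Q i) F i).
Proof.
have [P1 PD PZ _] := Palg; move=> PF; elim/big_ind: _ => //.
by rewrite -[0](scale0r (1 : 'M[K]_n)); apply: PZ.
Qed.

(** Lagrange interpolation: a polynomial in a diagonal matrix with distinct entries gives the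
    idempotent at [k]. *)
Lemma unital_subalgebra_diag r (k : 'I_n) : injective r ->
  P (diag_mx (\row_i r i)) -> P (delta_mx k k).
Proof.
have [P1 PD PZ PM] := Palg; move=> r_inj Pr.
have -> : delta_mx k k = (\prod_(i | i != k) (r k - r i)^-1) *:
    \prod_(i | i != k) (diag_mx (\row_j r j) - (r i)%:M) :> 'M[K]_n.
  have -> : \prod_(i | i != k) (diag_mx (\row_j r j) - (r i)%:M) =
      diag_mx (\row_j \prod_(i | i != k) (r j - r i)).
    pose D (f : 'I_n -> K) : 'M[K]_n := diag_mx (\row_j f j).
    rewrite -[RHS]/(D (fun j => \prod_(i | i != k) (r j - r i))).
    have D1 : D (fun=> 1) = 1 by apply/matrixP => i j; rewrite !mxE.
    have DM f g : D (fun j => f j * g j) = D f * D g.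
      by rewrite -mulmxE mulmx_diag; congr diag_mx; apply/rowP => j; rewrite !mxE.
    have DB i : D r - (r i)%:M = D (fun j => r j - r i).
      by rewrite -diag_const_mx -raddfB; congr diag_mx; apply/rowP => j; rewrite !mxE.
    elim: (index_enum _) => [|i s IH].
      rewrite big_nil -D1; congr diag_mx; apply/rowP => j.
      by rewrite !mxE big_nil.
    rewrite big_cons IH; case: ifP => ik; last first.
      by congr diag_mx; apply/rowP => j; rewrite !mxE big_cons ik.
    rewrite DB -DM; congr diag_mx; apply/rowP => j.
    by rewrite !mxE big_cons ik.
  apply/matrixP => i j; rewrite !mxE; have [<-{j}|nij] := eqVneq i j; last first.
    rewrite mulr0n mulr0; case: eqP => //= ik; case: eqP => // jk.
    by rewrite ik jk eqxx in nij.
  rewrite andbb mulr1n; have [->|nik] := eqVneq i k.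
    rewrite -big_split /= big1 // => j jk; rewrite mulVf // subr_eq0.
    by rewrite (inj_eq r_inj) eq_sym.
  by rewrite [X in _ * X](bigD1 i) //= subrr mul0r mulr0.
apply: (PZ); elim/big_ind: _ => // i _; apply: PD => //.
by rewrite -scaleN1r -scalemx1; apply: (PZ); apply: PZ.
Qed.

Lemma unital_subalgebra_full : (forall i j, P (delta_mx i j)) -> forall A, P A.
Proof.
have [_ _ PZ _] := Palg => Pd A; rewrite [A]matrix_sum_delta.
by do 2!(apply: unital_subalgebra_sum => ?); apply: PZ.
Qed.

End FullMatrixAlgebra.

(** Primitivity makes the diagonal entries of [geom_mx m q] distinct, which yields the diagonal
    units; powers of the shift move them to any row. *)
Lemma unital_subalgebra_shift (K : fieldType) m (P : 'M[K]_m.+1 -> Prop) (q : K) :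
  unital_subalgebra P -> m.+1.-primitive_root q -> P (shift_mx K m) ->
  P (geom_mx m q) -> forall A, P A.
Proof.
move=> Palg q_prim PS PQ; apply: (unital_subalgebra_full Palg) => i k.
have [P1 _ _ PM] := Palg.
have Pk : P (delta_mx k k).
  apply: (unital_subalgebra_diag Palg k (r := fun i : 'I_m.+1 => q ^+ i) _ PQ).
  move=> x y /eqP.
  rewrite (eq_prim_root_expr q_prim) !modn_small // => /eqP; exact: val_inj.
have shiftX t : shift_mx K m ^+ t * delta_mx k k = delta_mx (iter t (@ordS _) k) k.
  elim: t => [|t IH]; first by rewrite expr0 mul1r.
  rewrite exprS -mulrA IH iterS; apply/matrixP => a b; rewrite -mulmxE !mxE.
  rewrite (bigD1 (iter t (@ordS _) k)) //= big1 => [|c nc].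
    by rewrite !mxE eqxx addr0 /= -natrM mulnb.
  by rewrite !mxE (negbTE nc) mulr0.
have iterE t : val (iter t (@ordS _) k) = ((k + t) %% m.+1)%N.
  elim: t => [|t IH]; first by rewrite addn0 modn_small.
  by rewrite iterS /= IH -addn1 modnDml addn1 addnS.
(* This number of steps is i - k modulo [m.+1], written without a negative difference. *)
have -> : i = iter (i + (m.+1 - k))%N (@ordS _) k.
  apply: val_inj; rewrite iterE addnCA subnKC ?modnDr ?modn_small //.
  exact: ltnW.
rewrite -shiftX; apply: (PM _ _ _ Pk); elim: (_ + _)%N => [|t IH] //.
by rewrite exprS; apply: PM.
Qed.

(** * Linear independence of the coefficient functions *)

Section Independence.
Variable K : closedFieldType.

(** If [p] were nonzero, X p + 1 would have a root; the root is not 0, so [p] vanishes there and 1 =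
    0 follows. *)
Lemma poly_eq0_of_values (p : {poly K}) :
  (forall x, x != 0 -> p.[x] = 0) -> p = 0.
Proof.
move=> p0; apply/eqP; apply/negPn/negP => np.
have /closed_rootP[x] : size ('X * p + 1) != 1%N.
  have sp : (0 < size p)%N by rewrite size_poly_gt0.
  have sX : size ('X * p) = (size p).+1 by rewrite mulrC size_mulX.
  by rewrite size_polyDl sX ?size_poly1 // eqSS -lt0n.
rewrite rootE !hornerE; have [->|x0] := eqVneq x 0.
  by rewrite mul0r add0r oner_eq0.
by rewrite p0 // mulr0 add0r oner_eq0.
Qed.

Lemma size_independent N (f : nat -> {poly K}) (k : nat -> K) :
  (forall i, size (f i) = i.+1) -> \sum_(i < N) k i *: f i = 0 ->
  forall i, (i < N)%N -> k i = 0.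
Proof.
move=> sf; elim: N => // N IH; rewrite big_ord_recr /= => sum0.
have kN : k N = 0.
  have /(congr1 (fun p : {poly K} => p`_N)) := sum0.
  rewrite coefD coef_sum big1 => [|i _]; last first.
    by rewrite coefZ nth_default ?mulr0 // sf.
  rewrite add0r coefZ coef0 => /eqP; rewrite mulf_eq0 => /orP[/eqP//|].
  have := lead_coef_eq0 (f N); rewrite lead_coefE sf /= => ->.
  by rewrite -size_poly_eq0 sf.
move: sum0; rewrite kN scale0r addr0 => /IH kP i.
by rewrite ltnS leq_eqVlt => /predU1P[->|/kP].
Qed.

(** For fixed [al], on which [b] depends, the products are polynomials in [s] with pairwise distinct
    degrees, hence independent. Each of their coefficients is a polynomial in [al] that vanishes at
    all nonzero values. *)
Lemma weyl_coef_independent (q : K) N (k : 'I_N * 'I_N -> K) : q != 0 ->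
  (forall al s, al != 0 ->
     \sum_u k u * weyl_coef q al s (val u.1, val u.2) = 0) ->
  forall u, k u = 0.
Proof.
(* Extension by zero to all natural exponents, the form used by [size_independent]. *)
move=> q0 k0 [a c]; pose k' (a c : nat) : K :=
  if insub a is Some a' then if insub c is Some c' then k (a', c') else 0 else 0.
have k'E (i j : 'I_N) : k' i j = k (i, j) by rewrite /k' !valK.
have k'0 j al : (j < N)%N -> al != 0 -> \sum_(i < N) k' i j * al ^+ i = 0.
  move=> jN al0; pose b := al^-1 / (q - 1).
  pose f j := \prod_(i < j) (q^-1 ^+ i *: 'X - b%:P).
  apply: (@size_independent N f (fun j => \sum_(i < N) k' i j * al ^+ i)) jN.
    elim=> [|i IH]; rewrite /f ?big_ord0 ?size_poly1 // big_ord_recr /= mulrC.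
    have f0 : f i != 0 by rewrite -size_poly_eq0 IH.
    have lin : size (q^-1 ^+ i *: 'X - b%:P) = 2%N.
      have qi : q^-1 ^+ i != 0 by rewrite expf_neq0 ?invr_neq0.
      rewrite size_polyDl size_scale ?size_polyX // size_polyN.
      exact: leq_ltn_trans (size_polyC_leq1 _) _.
    by rewrite size_mul // -?size_poly_eq0 ?lin // IH.
  apply: poly_eq0_of_values => s _; rewrite horner_sum -[RHS](k0 al s al0).
  rewrite [RHS](eq_bigr (fun u => k (u.1, u.2) *
    weyl_coef q al s (val u.1, val u.2))); last by case.
  rewrite -(pair_bigA _ (fun i j => k (i, j) * weyl_coef q al s (val i, val j))) /=.
  rewrite exchange_big; apply: eq_bigr => i _.
  rewrite hornerZ horner_prod mulr_suml; apply: eq_bigr => i' _.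
  rewrite k'E /weyl_coef /= !mulrA; congr (_ * _); apply: eq_bigr => t _.
  by rewrite !hornerE mulrC.
have /polyP/(_ a) : \poly_(i < N) k' i c = 0.
  apply: poly_eq0_of_values => al al0; rewrite horner_poly.
  by apply: k'0.
by rewrite coef_poly ltn_ord k'E coef0.
Qed.

End Independence.

(** * Representations of the Weyl algebra *)

Section Tensor.
Variables (R : comNzRingType) (m n p r : nat).
Implicit Types (A : 'M[R]_(m, n)) (B : 'M[R]_(p, r)).

Lemma tensmxZl c A B : (c *: A) *t B = c *: (A *t B).
Proof. by apply/matrixP => i j; rewrite !mxE mulrA. Qed.

Lemma tensmxZr c A B : A *t (c *: B) = c *: (A *t B).
Proof. by apply/matrixP => i j; rewrite !mxE mulrCA. Qed.

Lemma tensmxBl A A' B : (A - A') *t B = A *t B - A' *t B.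
Proof. by apply/matrixP => i j; rewrite !mxE mulrBl. Qed.

Lemma tensmxBr A B B' : A *t (B - B') = A *t B - A *t B'.
Proof. by apply/matrixP => i j; rewrite !mxE mulrBr. Qed.

End Tensor.

Section TensorSquare.
Variables (R : comNzRingType) (m n : nat).

Lemma mxtens_index_inj : injective (@mxtens_index m n).
Proof. exact: can_inj (@mxtens_indexK m n). Qed.

Lemma tensmx_delta (i i' : 'I_m) (j j' : 'I_n) :
  delta_mx i i' *t delta_mx j j' =
  delta_mx (mxtens_index (i, j)) (mxtens_index (i', j')) :> 'M[R]_(m * n).
Proof.
apply/matrixP => k k'; case: (mxtens_indexP k) => a b; case: (mxtens_indexP k') => a' b'.
rewrite tensmxE !mxE !(inj_eq mxtens_index_inj) !xpair_eqE -natrM mulnb.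
by congr (_%:R); rewrite andbACA.
Qed.

Lemma tensmx11 : 1 *t 1 = 1 :> 'M[R]_(m * n).
Proof.
apply/matrixP => k k'; case: (mxtens_indexP k) => a b; case: (mxtens_indexP k') => a' b'.
by rewrite tensmxE !mxE (inj_eq mxtens_index_inj) xpair_eqE -natrM mulnb.
Qed.

Lemma tensmxM (A A' : 'M[R]_m) (B B' : 'M[R]_n) :
  (A *t B) * (A' *t B') = (A * A') *t (B * B').
Proof. by rewrite -!mulmxE tensmx_mul. Qed.

Lemma tensmxX (A : 'M[R]_m) (B : 'M[R]_n) k :
  (A *t B) ^+ k = (A ^+ k) *t (B ^+ k).
Proof.
by elim: k => [|k IH]; rewrite ?expr0 ?tensmx11 // !exprS IH tensmxM.
Qed.

End TensorSquare.

Section MatrixRepresentation.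
Variables (K : fieldType) (A : algType K) (n : nat).

(* Matrices of size 0 are not an [algType], hence no {lrmorphism A -> 'M_n}. *)
Definition mx_rep (rho : A -> 'M[K]_n) :=
  [/\ rho 1 = 1, {morph rho : x y / x + y}, scalable rho &
      {morph rho : x y / x * y}].

Variable rho : A -> 'M[K]_n.
Hypothesis rhoP : mx_rep rho.

Lemma mx_rep_sum (I : finType) (F : I -> A) :
  rho (\sum_i F i) = \sum_i rho (F i).
Proof.
have [_ rhoD rhoZ _] := rhoP; apply: (big_morph rho rhoD).
by rewrite -[0 in LHS](scale0r (1 : A)) rhoZ scale0r.
Qed.

Lemma mx_rep_multilinear d (c : 'S_d -> K) (a : 'I_d -> A) :
  rho (multilinear_eval c a) = \sum_s c s *: \prod_i rho (a (s i)).
Proof.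
have [rho1 _ rhoZ rhoM] := rhoP; rewrite mx_rep_sum; apply: eq_bigr => s _.
by rewrite rhoZ (big_morph rho rhoM rho1).
Qed.

Lemma mx_repX x k : rho (x ^+ k) = rho x ^+ k.
Proof.
have [rho1 _ _ rhoM] := rhoP.
by elim: k => [|k IH]; rewrite ?expr0 // !exprS rhoM IH.
Qed.

Lemma mx_rep_normal_mono x1 y1 x2 y2 t :
  rho (normal_mono x1 y1 x2 y2 t) =
  rho y1 ^+ t.1.1 * rho x1 ^+ t.1.2 * (rho y2 ^+ t.2.1 * rho x2 ^+ t.2.2).
Proof.
have [_ _ _ rhoM] := rhoP.
by rewrite /normal_mono !rhoM !mx_repX.
Qed.

End MatrixRepresentation.

Section Weyl.
Variables (K : fieldType) (q1 q2 lam : K) (lam_neq0 : lam != 0).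
Local Notation A := (alt_quantum_weyl q1 q2 lam_neq0).
Local Notation proper := (weyl_relators_proper (q1 := q1) (q2 := q2) lam_neq0).

Definition aqw_x1 : A := presented_pi proper (weyl_x1 K).
Definition aqw_y1 : A := presented_pi proper (weyl_y1 K).
Definition aqw_x2 : A := presented_pi proper (weyl_x2 K).
Definition aqw_y2 : A := presented_pi proper (weyl_y2 K).

Lemma weyl_relation p : p \in weyl_relators q1 q2 lam ->
  presented_pi proper p = 0.
Proof.
move=> p_rel; rewrite -[0](raddf0 (presented_pi proper)).
by apply/presented_piP; rewrite subr0; apply: gen_ideal_mem.
Qed.

(** Normal combinations contain 1 and are stable under left multiplication by each generator, which
    is what [presented_free_ind] asks for. *)
Lemma weyl_normal_span (z : A) : normal_span aqw_x1 aqw_y1 aqw_x2 aqw_y2 z.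
Proof.
have pi_rel p r c s t :
    presented_pi proper (p * r - c *: (s * t)) =
    presented_pi proper p * presented_pi proper r -
      c *: (presented_pi proper s * presented_pi proper t).
  by rewrite raddfB /= presented_piZ !presented_piM.
have pi_rel1 p r c s t :
    presented_pi proper (p * r - c *: (s * t) - 1) =
    presented_pi proper p * presented_pi proper r -
      c *: (presented_pi proper s * presented_pi proper t) - 1.
  by rewrite raddfB /= pi_rel.
have mem i : (i < 6)%N -> nth 0 (weyl_relators q1 q2 lam) i \in weyl_relators q1 q2 lam.
  by move=> i6; apply: mem_nth.
have r0 := etrans (esym (pi_rel _ _ _ _ _)) (weyl_relation (mem 0%N isT)).
have r1 := etrans (esym (pi_rel _ _ _ _ _)) (weyl_relation (mem 1%N isT)).
have r2 := etrans (esym (pi_rel _ _ _ _ _)) (weyl_relation (mem 2%N isT)).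
have r3 := etrans (esym (pi_rel _ _ _ _ _)) (weyl_relation (mem 3%N isT)).
have r4 := etrans (esym (pi_rel1 _ _ _ _ _)) (weyl_relation (mem 4%N isT)).
have r5 := etrans (esym (pi_rel1 _ _ _ _ _)) (weyl_relation (mem 5%N isT)).
have {}r0 := subr0_eq r0; have {}r1 := subr0_eq r1.
have {}r2 := subr0_eq r2; have {}r3 := subr0_eq r3.
move: z; apply: (@presented_free_ind _ _ _ proper).
- exact: normal_span1.
- exact: normal_spanD.
- exact: normal_spanZ.
move=> i z; rewrite -(inord_val i); case: i => [[|[|[|[|i]]]] ?] //=.
- by rewrite -/(weyl_x1 K) -/aqw_x1 => ?; apply: (normal_span_x1 r4).
- by rewrite -/(weyl_y1 K) -/aqw_y1 => ?; apply: normal_span_y1.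
- by rewrite -/(weyl_x2 K) -/aqw_x2 => ?; apply: (normal_span_x2 lam_neq0 r0 r3 r5).
- by rewrite -/(weyl_y2 K) -/aqw_y2 => ?; apply: (normal_span_y2 lam_neq0 r1 r2).
Qed.

Lemma weyl_mx_rep n (X1 Y1 X2 Y2 : 'M[K]_n) :
  X1 * X2 = lam *: (X2 * X1) -> X1 * Y2 = lam^-1 *: (Y2 * X1) ->
  Y1 * Y2 = lam *: (Y2 * Y1) -> Y1 * X2 = lam^-1 *: (X2 * Y1) ->
  X1 * Y1 - q1 *: (Y1 * X1) - 1 = 0 -> X2 * Y2 - q2 *: (Y2 * X2) - 1 = 0 ->
  exists2 rho : A -> 'M[K]_n, mx_rep rho &
    [/\ rho aqw_x1 = X1, rho aqw_y1 = Y1, rho aqw_x2 = X2 & rho aqw_y2 = Y2].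
Proof.
case: n X1 Y1 X2 Y2 => [|n] X1 Y1 X2 Y2 r1 r2 r3 r4 r5 r6.
  have eq0 (B C : 'M[K]_0) : B = C by rewrite [B]flatmx0 [C]flatmx0.
  by exists (fun=> 0); split; repeat move=> ?; apply: eq0.
pose g (i : 'I_4) := match val i with 0 => X1 | 1 => Y1 | 2 => X2 | _ => Y2 end.
have gE i : (i < 4)%N -> free_lift g (free_gen K (inord i)) =
    match i with 0 => X1 | 1 => Y1 | 2 => X2 | _ => Y2 end.
  by move=> i4; rewrite free_lift_gen /g /= inordK.
have gx1 : free_lift g (weyl_x1 K) = X1 := gE 0%N isT.
have gy1 : free_lift g (weyl_y1 K) = Y1 := gE 1%N isT.
have gx2 : free_lift g (weyl_x2 K) = X2 := gE 2%N isT.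
have gy2 : free_lift g (weyl_y2 K) = Y2 := gE 3%N isT.
have rels0 p : p \in weyl_relators q1 q2 lam -> free_lift g p = 0.
  refine (@seq6_ind _ (fun p => free_lift g p = 0) _ _ _ _ _ _ _ _ _ _ _ _ p).
  - by apply: etrans (free_lift_rel _ _ _ _ _ _) _; rewrite gx1 gx2 r1 subrr.
  - by apply: etrans (free_lift_rel _ _ _ _ _ _) _; rewrite gx1 gy2 r2 subrr.
  - by apply: etrans (free_lift_rel _ _ _ _ _ _) _; rewrite gy1 gy2 r3 subrr.
  - by apply: etrans (free_lift_rel _ _ _ _ _ _) _; rewrite gy1 gx2 r4 subrr.
  - by apply: etrans (free_lift_rel1 _ _ _ _ _ _) _; rewrite gx1 gy1.
  - by apply: etrans (free_lift_rel1 _ _ _ _ _ _) _; rewrite gx2 gy2.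
have [rho rhoE] := presented_lift proper rels0.
exists rho; first by split=> [|x y|c x|x y]; rewrite ?rmorph1 ?raddfD ?linearZ ?rmorphM.
by split; rewrite rhoE /g /= inordK.
Qed.

End Weyl.

Section Representation.
Variables (K : fieldType) (q1 q2 lam : K) (m1 m2 : nat).
Local Notation l1 := m1.+1.
Local Notation l2 := m2.+1.
Hypotheses (lam_neq0 : lam != 0) (q1_neq1 : q1 != 1) (q2_neq1 : q2 != 1).
Hypotheses (q1l : q1 ^+ l1 = 1) (q2l : q2 ^+ l2 = 1) (laml : lam ^+ l1 = 1).
Local Notation A := (alt_quantum_weyl q1 q2 lam_neq0).

(** The diagonal twists on the first factor produce the powers of [lam] between the modes, using
    [laml] at the wrap-around. Being inverse to each other, they cancel in the products of [x2] and
    [y2], so the relation of mode 2 survives. *)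
Lemma weyl_tensor_rep al1 s1 al2 s2 : al1 != 0 -> al2 != 0 ->
  exists2 rho : A -> 'M[K]_(l1 * l2), mx_rep rho &
    [/\ rho (aqw_x1 q1 q2 lam_neq0) = weyl_x m1 q1 al1 s1 *t 1,
        rho (aqw_y1 q1 q2 lam_neq0) = weyl_y m1 al1 *t 1,
        rho (aqw_x2 q1 q2 lam_neq0) = geom_mx m1 lam *t weyl_x m2 q2 al2 s2 &
        rho (aqw_y2 q1 q2 lam_neq0) = geom_mx m1 lam^-1 *t weyl_y m2 al2].
Proof.
move=> al1_neq0 al2_neq0.
have lamVl : lam^-1 ^+ l1 = 1 by rewrite exprVn laml invr1.
apply: weyl_mx_rep; rewrite !tensmxM ?mul1r ?mulr1.
- by rewrite weyl_x_geom // tensmxZl.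
- by rewrite weyl_x_geom // tensmxZl.
- by rewrite weyl_y_geom // tensmxZl scalerA mulfV // scale1r.
- by rewrite weyl_y_geom // tensmxZl scalerA mulVf // scale1r.
- rewrite -tensmxZl -tensmx11 -!tensmxBl weyl_rel //; exact: tens0mx.
- rewrite !geom_mxM mulfV // mulVf // geom_mx1 -tensmxZr -tensmx11 -!tensmxBr.
  by rewrite weyl_rel //; apply: tensmx0.
Qed.

(** In normal order the twists stand to the right of the mode 1 matrices and fix the base vector, so
    the matrix coefficient factors into the two modes. *)
Lemma weyl_tensor_rep_mono al1 s1 al2 s2 (rho : A -> 'M[K]_(l1 * l2)) t :
  mx_rep rho ->
  [/\ rho (aqw_x1 q1 q2 lam_neq0) = weyl_x m1 q1 al1 s1 *t 1,
      rho (aqw_y1 q1 q2 lam_neq0) = weyl_y m1 al1 *t 1,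
      rho (aqw_x2 q1 q2 lam_neq0) = geom_mx m1 lam *t weyl_x m2 q2 al2 s2 &
      rho (aqw_y2 q1 q2 lam_neq0) = geom_mx m1 lam^-1 *t weyl_y m2 al2] ->
  (ones K m1 *t ones K m2) *m
    rho (normal_mono (aqw_x1 q1 q2 lam_neq0) (aqw_y1 q1 q2 lam_neq0)
                     (aqw_x2 q1 q2 lam_neq0) (aqw_y2 q1 q2 lam_neq0) t) *m
    (base_col K m1 *t base_col K m2) =
  (weyl_coef q1 al1 s1 t.1 * weyl_coef q2 al2 s2 t.2) *:
    ((ones K m1 *m base_col K m1) *t (ones K m2 *m base_col K m2)).
Proof.
move=> rhoP [rx1 ry1 rx2 ry2].
have geomX r k : geom_mx m1 r ^+ k *m base_col K m1 = base_col K m1.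
  elim: k => [|k IH]; first by rewrite expr0 mul1mx.
  by rewrite exprSr -mulmxE -mulmxA geom_e0 IH.
rewrite (mx_rep_normal_mono rhoP) rx1 ry1 rx2 ry2 {rx1 ry1 rx2 ry2}.
have tensE (B C : 'M[K]_l1) (D : 'M[K]_l2) :
    (ones K m1 *t ones K m2) *m ((B * C) *t D) *m (base_col K m1 *t base_col K m2) =
    (ones K m1 *m B *m (C *m base_col K m1)) *t (ones K m2 *m D *m base_col K m2).
  by rewrite -mulmxE !tensmx_mul !mulmxA.
rewrite !tensmxX !expr1n !tensmxM mulr1 mul1r tensE.
rewrite [X in _ *m X](_ : _ = base_col K m1); last by rewrite -mulmxE -mulmxA !geomX.
by rewrite !ones_weyl_coef // tensmxZl tensmxZr scalerA.
Qed.

End Representation.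

(** * The PI-degree *)

Lemma ones_e0 (K : fieldType) m : ones K m *m base_col K m = const_mx 1.
Proof.
apply/matrixP => i j; rewrite !mxE (bigD1 0) //= big1 => [|k nk].
  by rewrite !mxE ord1 eqxx mulr1 addr0.
by rewrite !mxE (negbTE nk) mulr0.
Qed.

Section MatrixImage.
Variables (K : fieldType) (A : algType K) (n : nat) (rho : A -> 'M[K]_n).
Hypothesis rhoP : mx_rep rho.

Definition in_image (B : 'M[K]_n) := exists x, rho x = B.

Lemma in_image_subalg : unital_subalgebra in_image.
Proof.
have [rho1 rhoD rhoZ rhoM] := rhoP; split.
- by exists 1.
- by move=> _ _ [x <-] [y <-]; exists (x + y); rewrite rhoD.
- by move=> c _ [x <-]; exists (c *: x); rewrite rhoZ.
- by move=> _ _ [x <-] [y <-]; exists (x * y); rewrite rhoM.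
Qed.

End MatrixImage.

Section Main.
Variables (K : closedFieldType) (q1 q2 lam : K) (m1 m2 : nat).
Local Notation l1 := m1.+1.
Local Notation l2 := m2.+1.
Hypotheses (q1_neq0 : q1 != 0) (q2_neq0 : q2 != 0) (lam_neq0 : lam != 0).
Hypotheses (q1_neq1 : q1 != 1) (q2_neq1 : q2 != 1).
Hypotheses (q1_prim : l1.-primitive_root q1) (q2_prim : l2.-primitive_root q2).
Hypothesis laml : lam ^+ l1 = 1.
Local Notation A := (alt_quantum_weyl q1 q2 lam_neq0).
Local Notation tensor_rep := (weyl_tensor_rep lam_neq0 q1_neq1 q2_neq1
  (prim_expr_order q1_prim) (prim_expr_order q2_prim) laml).

(** Each representation gives one linear relation among the coefficients of [x]. Independence is
    used twice: in mode 1, for coefficients that are still functions of [al2] and [s2], and then in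
    mode 2. *)
Lemma weyl_reps_faithful (x : A) :
  (forall rho : A -> 'M[K]_(l1 * l2), mx_rep rho -> rho x = 0) -> x = 0.
Proof.
move=> x0; have [N [k xE]] := normal_span_box (weyl_normal_span x).
suff k0 u v : k (u, v) = 0.
  by rewrite xE big1 // => -[u v] _; rewrite k0 scale0r.
move: v; apply: (weyl_coef_independent q2_neq0) => al2 s2 al2_neq0; move: u.
apply: (weyl_coef_independent q1_neq0 (k := fun u => \sum_v k (u, v) *
  weyl_coef q2 al2 s2 (val v.1, val v.2))) => al1 s1 al1_neq0.
have [rho rhoP rho_gen] := tensor_rep s1 s2 al1_neq0 al2_neq0.
have [_ _ rhoZ _] := rhoP.
have : (ones K m1 *t ones K m2) *m rho x *m (base_col K m1 *t base_col K m2) = 0.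
  by rewrite x0 // mulmx0 mul0mx.
rewrite xE (mx_rep_sum rhoP) mulmx_sumr mulmx_suml.
under eq_bigr => t _.
  rewrite rhoZ -scalemxAr -scalemxAl.
  rewrite (weyl_tensor_rep_mono (prim_expr_order q1_prim)
    (prim_expr_order q2_prim) _ rhoP rho_gen).
  rewrite scalerA; over.
rewrite -scaler_suml !ones_e0 => /matrixP/(_ 0 0); rewrite !mxE !mulr1 => k0.
rewrite -[RHS]k0 [RHS](eq_bigr (fun t => k (t.1, t.2) * (weyl_coef q1 al1 s1
  (val t.1.1, val t.1.2) * weyl_coef q2 al2 s2 (val t.2.1, val t.2.2)))); last by case.
rewrite -(pair_bigA _ (fun u v => k (u, v) * (weyl_coef q1 al1 s1
  (val u.1, val u.2) * weyl_coef q2 al2 s2 (val v.1, val v.2)))).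
apply: eq_bigr => u _; rewrite mulr_suml; apply: eq_bigr => v _.
by rewrite /= -mulrA; congr (_ * _); rewrite mulrC.
Qed.

Lemma weyl_satisfies_identity : satisfies_monic_identity A (l1 * l2).*2.
Proof.
have [e [e1 eP]] := amitsur_levitzki (l1 * l2).
exists (fun s => (-1) ^+ e s); split; first by exists 1%g; rewrite e1.
move=> a; apply: weyl_reps_faithful => rho rhoP.
rewrite (mx_rep_multilinear rhoP); exact: (eP K (fun i => rho (a i))).
Qed.

(** With all parameters equal to 1, [y1] gives the shift and the commutator of mode 1 gives
    [geom_mx m1 q1], so the whole first factor lies in the image. It contains the twists, which can
    therefore be removed from mode 2 before the same argument is repeated there. *)
Lemma weyl_rep_surjective :
  exists2 rho : A -> 'M[K]_(l1 * l2), mx_rep rho & forall B, in_image rho B.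
Proof.
have [rho rhoP [rx1 ry1 rx2 ry2]] := tensor_rep 1 1 (oner_neq0 K) (oner_neq0 K).
exists rho => //; have imP := in_image_subalg rhoP.
have [P1 PD PZ PM] := imP.
have PB B C : in_image rho B -> in_image rho C -> in_image rho (B - C).
  by move=> PB PC; rewrite -scaleN1r; apply: (PD) => //; apply: (PZ).
have Zneq0 (q : K) : q != 1 -> q - 1 != 0 by rewrite subr_eq0.
have full1 (B : 'M[K]_l1) : in_image rho (B *t 1).
  apply: (unital_subalgebra_shift (P := fun B => in_image rho (B *t 1)) _ q1_prim).
  - split=> [|C D PC PD'|c C PC|C D PC PD'].
    + by rewrite tensmx11.
    + have -> : (C + D) *t 1 = C *t 1 + D *t 1 :> 'M[K]_(l1 * l2).
        by apply/matrixP => i j; rewrite !mxE mulrDl.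
      exact: PD.
    + by rewrite tensmxZl; apply: (PZ).
    + by have := PM _ _ PC PD'; rewrite tensmxM mulr1.
  - by exists (aqw_y1 q1 q2 lam_neq0); rewrite ry1 /weyl_y scale1r.
  - have : in_image rho ((weyl_x m1 q1 1 1 * weyl_y m1 1 -
        weyl_y m1 1 * weyl_x m1 q1 1 1) *t 1).
      rewrite tensmxBl -(mulr1 (1 : 'M[K]_l2)) -!tensmxM.
      by apply: PB; apply: PM; eexists; eassumption.
    rewrite weyl_comm ?(prim_expr_order q1_prim) // !mul1r tensmxZl.
    move=> /(PZ (q1 - 1)^-1); by rewrite scalerA mulVf ?scale1r ?Zneq0.
(* The twist of [x2] is undone by its inverse, which lies in the first factor. *)
have unx2 : in_image rho (1 *t weyl_x m2 q2 1 1).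
  have := PM _ _ (full1 (geom_mx m1 lam^-1)) (ex_intro _ _ rx2).
  by rewrite tensmxM geom_mxM mulVf // geom_mx1 mul1r.
have uny2 : in_image rho (1 *t weyl_y m2 1).
  have := PM _ _ (full1 (geom_mx m1 lam)) (ex_intro _ _ ry2).
  by rewrite tensmxM geom_mxM mulfV // geom_mx1 mul1r.
have full2 (B : 'M[K]_l2) : in_image rho (1 *t B).
  apply: (unital_subalgebra_shift (P := fun B => in_image rho (1 *t B)) _ q2_prim).
  - split=> [|C D PC PD'|c C PC|C D PC PD'].
    + by rewrite tensmx11.
    + have -> : 1 *t (C + D) = 1 *t C + 1 *t D :> 'M[K]_(l1 * l2).
        by apply/matrixP => i j; rewrite !mxE mulrDr.
      exact: PD.
    + by rewrite tensmxZr; apply: (PZ).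
    + by have := PM _ _ PC PD'; rewrite tensmxM mulr1.
  - by have := uny2; rewrite /weyl_y scale1r.
  - have : in_image rho (1 *t (weyl_x m2 q2 1 1 * weyl_y m2 1 -
        weyl_y m2 1 * weyl_x m2 q2 1 1)).
      rewrite tensmxBr -(mulr1 (1 : 'M[K]_l1)) -!tensmxM.
      by apply: PB; apply: (PM).
    rewrite weyl_comm ?(prim_expr_order q2_prim) // !mul1r tensmxZr.
    move=> /(PZ (q2 - 1)^-1); by rewrite scalerA mulVf ?scale1r ?Zneq0.
apply: (unital_subalgebra_full imP) => i j.
case: (mxtens_indexP i) => i1 i2; case: (mxtens_indexP j) => j1 j2.
rewrite -tensmx_delta -[delta_mx i1 j1]mulr1 -[delta_mx i2 j2]mul1r -tensmxM.
exact: PM.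
Qed.

(** An identity passes to the image of a representation, here a full matrix algebra. *)
Lemma weyl_identity_degree d :
  satisfies_monic_identity A d -> ((l1 * l2).*2 <= d)%N.
Proof.
move=> [c [c1 c0]]; have [rho rhoP rho_surj] := weyl_rep_surjective.
apply: (full_mx_identity_degree _ c1) => // a.
have [b bE] := choice (fun i => rho_surj (a i)).
rewrite -[RHS](_ : rho (multilinear_eval c b) = 0); last first.
  by rewrite c0 -(scale0r (1 : A)); have [_ _ -> _] := rhoP; rewrite scale0r.
rewrite (mx_rep_multilinear rhoP); apply: eq_bigr => s _; congr (_ *: _).
by apply: eq_bigr => i _; rewrite bE.
Qed.

End Main.

Theorem theorem3p2 (K : closedFieldType) (q1 q2 lam : K) (l1 l2 : nat)
    (q1_neq0 : q1 != 0) (q1_neq1 : q1 != 1)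
    (q2_neq0 : q2 != 0) (q2_neq1 : q2 != 1)
    (lam_neq0 : lam != 0)
    (q1_prim : l1.-primitive_root q1) (q2_prim : l2.-primitive_root q2)
    (lam_root : lam ^+ l1 = 1) :
  PI_degree (alt_quantum_weyl q1 q2 lam_neq0) (l1 * l2)%N.
Proof.
(* The order of a primitive root is positive, so [l1] and [l2] are successors, as the cyclic
   representations expect. *)
case: l1 q1_prim lam_root (prim_order_gt0 q1_prim) => // m1 q1_prim' lam_root _.
case: l2 q2_prim (prim_order_gt0 q2_prim) => // m2 q2_prim' _.
split; first exact: weyl_satisfies_identity.
by move=> d; apply: weyl_identity_degree.
Qed.
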